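(* Let $n\ge 2$, let $\mathbb B^n=\{x\in\mathbb R^n: |x|<1\}$ and let $d\nu(x)=(1-|x|^2)^{-n}\,dx$ on $\mathbb B^n$. Let $\Omega\subset\mathbb B^n$ be an open connected set containing the origin $0$ such that: (i) $\nu(\Omega)<+\infty$; (ii) for every compact set $K\subset\mathbb B^n$, $\displaystyle \sup_{z\in K}\int_\Omega |\xi-z|^{1-n}\,d\nu(\xi)<+\infty$; (iii) $\displaystyle \lim_{r\to1^-}(1-r^2)^{n-2}\sup_{z\in\Omega\cap\{|z|=r\}}\int_\Omega|\xi-z|^{1-n}\,d\nu(\xi)=0$; (iv) $\partial\Omega\cap\mathbb B^n=\partial\overline{\Omega}\cap\mathbb B^n$. Suppose that for every function $f$ which is $H$-harmonic in a neighbourhood of $\overline\Omega\cap\mathbb B^n$ and $\nu$-integrable on $\Omega$, one has $$\frac1{\nu(\Omega)}\int_\Omega f(x)\,d\nu(x)=f(0).$$ Then $\Omega$ is a hyperbolic ball centered at $0$; equivalently, there exists $0<R<1$ such that $\Omega=\{x\in\mathbb B^n: |x|<R\}$.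
   Context: For $f\in C^2$ on an open subset of $\mathbb B^n$, the (hyperbolic) invariant Laplacian is $$\Delta_h f(x)=(1-|x|^2)\left[(1-|x|^2)\Delta f(x)+2(n-2)\langle x,\nabla f(x)\rangle\right],$$ where $\Delta$ and $\nabla$ are the Euclidean Laplacian and gradient. A complex-valued function $f\in C^2(U)$, $U\subset\mathbb B^n$ open, is called $H$-harmonic on $U$ if $\Delta_h f(x)=0$ for all $x\in U$. Here $dx$ is Lebesgue measure, $\overline\Omega$ is the Euclidean closure, and ''neighbourhood of $\overline\Omega\cap\mathbb B^n$'' means an open subset of $\mathbb B^n$ containing $\overline\Omega\cap\mathbb B^n$. The supremum over an empty set of nonnegative quantities is taken to be $0$. *)

(* Defs.v *)
From HB Require Import structures.
From mathcomp Require Import all_boot all_order all_algebra.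
From mathcomp Require Import all_classical all_reals all_analysis.
From mathcomp Require Import measurable_realfun complex.

Set Implicit Arguments.
Unset Strict Implicit.
Unset Printing Implicit Defensive.

Import Order.TTheory GRing.Theory Num.Theory.
Import numFieldTopology.Exports numFieldNormedType.Exports.

Local Open Scope classical_set_scope.
Local Open Scope ring_scope.

(* R^n carries the sigma-algebra generated by the coordinates, i.e. the Borel
   sigma-algebra. *)
Definition rV_display : measure_display.
Proof. exact: default_measure_display. Qed.

Section measurable_rV.
Context {R : realType} (n : nat).

Let coord (i : 'I_n) (x : 'rV[R]_n) : R := x ord0 i.

Let rV_set0 : g_sigma_preimage coord set0.
Proof. exact: sigma_algebra0. Qed.

Let rV_setC A : g_sigma_preimage coord A -> g_sigma_preimage coord (~` A).
Proof. exact: sigma_algebraC. Qed.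

Let rV_bigcup (F : _^nat) : (forall i, g_sigma_preimage coord (F i)) ->
  g_sigma_preimage coord (\bigcup_i (F i)).
Proof. exact: sigma_algebra_bigcup. Qed.

HB.instance Definition _ := @isMeasurable.Build rV_display
  'rV[R]_n (g_sigma_preimage coord) rV_set0 rV_setC rV_bigcup.

End measurable_rV.

Lemma measurable_rV_coord (R : realType) n (i : 'I_n) :
  measurable_fun [set: 'rV[R]_n] (fun x : 'rV[R]_n => x ord0 i).
Proof.
move=> _ Y mY; rewrite setTI; apply: sub_sigma_algebra => /=.
rewrite -bigcup_seq/=; exists i => /=; first by rewrite mem_index_enum.
by exists Y => //; rewrite setTI.
Qed.

Lemma measurable_fun_rV d (T : measurableType d) (R : realType) n
    (f : T -> 'rV[R]_n) :
  (forall i, measurable_fun [set: T] (fun t => f t ord0 i)) ->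
  measurable_fun [set: T] f.
Proof.
move=> mf _ Y; pose Q := [set Y : set 'rV[R]_n | measurable (f @^-1` Y)].
rewrite setTI; suff : measurable `<=` Q by apply.
apply: smallest_sub; last first.
  rewrite -bigcup_seq; apply: bigcup_sub => i _ A [B mB <-].
  by rewrite /Q/= setTI; have := mf i measurableT B mB; rewrite setTI.
split=> /=.
- by rewrite /Q/= preimage_set0.
- by move=> A mA; rewrite /Q/= setTD -preimage_setC; exact: measurableC.
- move=> F mF; rewrite /Q/= preimage_bigcup; apply: bigcup_measurable => k _; exact: mF.
Qed.

(* (a, v) |-> (a, v_0, ..., v_{n-1}) *)
Definition rV_cons (R : realType) n (p : measurableTypeR R * 'rV[R]_n) : 'rV[R]_n.+1 :=
  row_mx p.1%:M p.2.

Lemma measurable_rV_cons (R : realType) n :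
  measurable_fun [set: measurableTypeR R * 'rV[R]_n] (@rV_cons R n).
Proof.
apply: measurable_fun_rV => i.
case: (@split_ordP 1 n i) => j ->.
  rewrite [X in measurable_fun _ X](_ : _ = fst)//.
  by apply/funext => p /=; rewrite /rV_cons (@row_mxEl _ 1 1 n) (ord1 j) !mxE eqxx.
rewrite [X in measurable_fun _ X](_ : _ =
    (fun x : 'rV[R]_n => x ord0 j) \o snd).
  apply: measurableT_comp => //; exact: measurable_rV_coord.
by apply/funext => p /=; rewrite /rV_cons (@row_mxEr _ 1 1 n).
Qed.

Definition rV_uncons (R : realType) n (w : 'rV[R]_n.+1) :
    measurableTypeR R * 'rV[R]_n :=
  (w ord0 ord0, \row_j w ord0 (rshift 1 j)).

Lemma rV_consK (R : realType) n : cancel (@rV_cons R n) (@rV_uncons R n).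
Proof.
move=> [a v]; rewrite /rV_uncons /rV_cons/=; congr pair.
  have -> : ord0 = lshift n (ord0 : 'I_1) by exact: val_inj.
  by rewrite (@row_mxEl _ 1 1 n) !mxE eqxx.
by apply/rowP => j; rewrite mxE (@row_mxEr _ 1 1 n).
Qed.

Lemma measurable_rV_uncons (R : realType) n :
  measurable_fun [set: 'rV[R]_n.+1] (@rV_uncons R n).
Proof.
apply: measurable_fun_pair; first exact: measurable_rV_coord.
apply: measurable_fun_rV => j.
rewrite [X in measurable_fun _ X](_ : _ =
    (fun x : 'rV[R]_n.+1 => x ord0 (rshift 1 j))).
  exact: measurable_rV_coord.
by apply/funext => x; rewrite mxE.
Qed.

Section lebesgue_step.
Context (R : realType) (n : nat).
Variable mu : {sigma_finite_measure set 'rV[R]_n -> \bar R}.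

Definition lebesgue_step : set 'rV[R]_n.+1 -> \bar R :=
  pushforward (lebesgue_measure \x mu)%E (@rV_cons R n).

Let mcons := @measurable_rV_cons R n.

Let lebesgue_step0 : lebesgue_step set0 = 0%E.
Proof. exact: measure0. Qed.

Let lebesgue_step_ge0 A : (0 <= lebesgue_step A)%E.
Proof. exact: measure_ge0. Qed.

Let lebesgue_step_sigma_additive : semi_sigma_additive lebesgue_step.
Proof. exact: measure_semi_sigma_additive. Qed.

HB.instance Definition _ := isMeasure.Build _ _ _ lebesgue_step
  lebesgue_step0 lebesgue_step_ge0 lebesgue_step_sigma_additive.

Let lebesgue_step_sigma_finite : sigma_finite setT lebesgue_step.
Proof.
have /sigma_finiteP[F [FT ndF mF]] := sigma_finiteT (@lebesgue_measure R).
have /sigma_finiteP[G [GT ndG mG]] := sigma_finiteT mu.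
exists (fun k => @rV_uncons R n @^-1` (F k `*` G k)).
  rewrite -preimage_bigcup -(preimage_setT (@rV_uncons R n)); congr preimage.
  apply/seteqP; split=> [[a v] _|//] /=.
  have [i _ Fa] : (\bigcup_i F i) a by rewrite -FT.
  have [j _ Gv] : (\bigcup_i G i) v by rewrite -GT.
  exists (maxn i j) => //; split=> /=.
    by move: a Fa; exact/subsetPset/ndF/leq_maxl.
  by move: v Gv; exact/subsetPset/ndG/leq_maxr.
move=> k; have [mFk Fk] := mF k; have [mGk Gk] := mG k; split.
  rewrite -[X in measurable X]setTI; apply: measurable_rV_uncons => //.
  exact: measurableX.
rewrite /lebesgue_step /pushforward -comp_preimage (_ : _ \o _ = id).
  by rewrite preimage_id product_measure1E// lte_mul_pinfty// ge0_fin_numE.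
by apply/funext => p; exact: rV_consK.
Qed.

HB.instance Definition _ := @Measure_isSigmaFinite.Build _ _ _
  lebesgue_step lebesgue_step_sigma_finite.

End lebesgue_step.

(* Lebesgue measure on R^n: dx = dx_0 ... dx_{n-1}; R^0 is a point of mass 1. *)
Fixpoint lebesgue_rV (R : realType) n :
    {sigma_finite_measure set 'rV[R]_n -> \bar R} :=
  if n is k.+1 then lebesgue_step (lebesgue_rV R k) else dirac (0 : 'rV[R]_0).

Section hyperbolic_ball.
Context {R : realType} {n : nat}.
Implicit Types x y : 'rV[R]_n.

Definition dotp x y : R := \sum_(i < n) x ord0 i * y ord0 i.

(* The library norm `|x| on 'rV[R]_n is the sup norm. *)
Definition enorm x : R := Num.sqrt (dotp x x).

Definition unit_ball : set 'rV[R]_n := [set x | enorm x < 1].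

Lemma measurable_enorm_sqr :
  measurable_fun [set: 'rV[R]_n] (fun x => enorm x ^+ 2).
Proof.
rewrite [X in measurable_fun _ X](_ : _ =
    (fun x => \sum_(i < n) x ord0 i ^+ 2)); last first.
  apply/funext => x; rewrite sqr_sqrtr; first exact: eq_bigr.
  by apply: sumr_ge0 => i _; exact: sqr_ge0.
apply: measurable_sum => i.
apply: measurable_funX; exact: measurable_rV_coord.
Qed.

Lemma unit_ballE : unit_ball = [set x | enorm x ^+ 2 < 1].
Proof.
by apply/seteqP; split=> x /=; rewrite /unit_ball/= expr_lt1// sqrtr_ge0.
Qed.

Lemma measurable_unit_ball : measurable unit_ball.
Proof.
rewrite unit_ballE (_ : [set _ | _] =
    [set: 'rV[R]_n] `&` (fun x => enorm x ^+ 2) @^-1` `]-oo, 1[).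
  by apply: measurable_enorm_sqr => //; exact: measurable_itv.
by rewrite setTI; apply/seteqP; split=> x /=; rewrite in_itv.
Qed.

Definition hyp_density x : R := (1 - enorm x ^+ 2) ^- n.

Lemma measurable_hyp_density : measurable_fun unit_ball hyp_density.
Proof.
apply: (eq_measurable_fun (fun x => (1 - enorm x ^+ 2) `^ (- n%:R))).
  move=> x; rewrite inE unit_ballE /= => x1.
  by rewrite powRN powR_mulrn// subr_ge0 ltW.
apply: measurable_funTS.
apply: (measurableT_comp (measurable_powR _)).
apply: measurable_funB; first exact: measurable_cst.
exact: measurable_enorm_sqr.
Qed.

Lemma hyp_density_ge0 x : unit_ball x -> 0 <= hyp_density x.
Proof.
by rewrite unit_ballE /= => x1; rewrite invr_ge0 exprn_ge0// subr_ge0 ltW.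
Qed.

(* Defined on all of R^n, carried by the unit ball. *)
Definition nu (A : set 'rV[R]_n) : \bar R :=
  (\int[lebesgue_rV R n]_(x in A `&` unit_ball) (hyp_density x)%:E)%E.

Let nu0 : nu set0 = 0%E.
Proof. by rewrite /nu set0I integral_set0. Qed.

Let nu_ge0 A : (0 <= nu A)%E.
Proof.
by apply: integral_ge0 => x [_ xB]; rewrite lee_fin hyp_density_ge0.
Qed.

Let nu_sigma_additive : semi_sigma_additive nu.
Proof.
move=> F mF tF mUF; rewrite /nu setI_bigcupl.
have mFB k : measurable (F k `&` unit_ball).
  by apply: measurableI => //; exact: measurable_unit_ball.
rewrite ge0_integral_bigcup//=.
- by apply: is_cvg_ereal_nneg_natsum_cond => k _ _; exact: nu_ge0.
- apply/measurable_EFinP; apply: measurable_funS measurable_hyp_density.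
  + exact: measurable_unit_ball.
  + by move=> x [k _ []].
- by move=> x [k _ [_ xB]]; rewrite lee_fin hyp_density_ge0.
- apply/trivIsetP => i j _ _ ij; move/trivIsetP : tF => /(_ i j I I ij) FF.
  by rewrite setIACA FF set0I.
Qed.

HB.instance Definition _ := isMeasure.Build _ _ _ nu
  nu0 nu_ge0 nu_sigma_additive.

End hyperbolic_ball.
Arguments unit_ball : clear implicits.
Arguments nu : clear implicits.

Section H_harmonic.
Context {R : realType} {n : nat}.
Implicit Types (x : 'rV[R]_n) (u : 'rV[R]_n -> R) (f : 'rV[R]_n -> R[i]).
Implicit Types U : set 'rV[R]_n.

Definition partial (i : 'I_n) u x : R := 'D_(delta_mx ord0 i) u x.

Definition partial_ex (i : 'I_n) u x : Prop := derivable u x (delta_mx ord0 i).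

Definition C2_on U u : Prop := forall x, U x ->
  [/\ {for x, continuous u},
      forall i, partial_ex i u x /\ {for x, continuous (partial i u)} &
      forall i j, partial_ex i (partial j u) x /\
                  {for x, continuous (partial i (partial j u))}].

Definition laplacian u x : R := \sum_(i < n) partial i (partial i u) x.

Definition gradient u x : 'rV[R]_n := \row_i partial i u x.

Definition invariant_laplacian u x : R :=
  (1 - enorm x ^+ 2) *
  ((1 - enorm x ^+ 2) * laplacian u x +
   2 * (n%:R - 2) * dotp x (gradient u x)).

(* Derivatives and integrals of complex-valued functions are taken
   componentwise. *)
Definition reC f : 'rV[R]_n -> R := fun x => complex.Re (f x).
Definition imC f : 'rV[R]_n -> R := fun x => complex.Im (f x).

Definition invariant_laplacianC f x : R[i] :=
  Complex (invariant_laplacian (reC f) x) (invariant_laplacian (imC f) x).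

Definition H_harmonic U f : Prop :=
  [/\ C2_on U (reC f), C2_on U (imC f) &
      forall x, U x -> invariant_laplacianC f x = 0].

Definition nu_integrable (D : set 'rV[R]_n) f : Prop :=
  (nu R n).-integrable D (EFin \o reC f) /\
  (nu R n).-integrable D (EFin \o imC f).

Definition nu_integral (D : set 'rV[R]_n) f : R[i] :=
  Complex (\int[nu R n]_(x in D) reC f x) (\int[nu R n]_(x in D) imC f x).

End H_harmonic.

Section domain_conditions.
Context {R : realType} {n : nat}.
Implicit Types (z : 'rV[R]_n) (D : set 'rV[R]_n).

(* The integrand at xi = z, where the library sets 0^-1 = 0, is irrelevant:
   nu [set z] = 0. *)
Definition nu_potential D z : \bar R :=
  (\int[nu R n]_(xi in D) (enorm (xi - z) ^ (1 - n%:Z))%:E)%E.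

(* Supremum in [0, +oo]; adjoining 0 makes the supremum over set0 equal to 0. *)
Definition nnsup (S : set (\bar R)) : \bar R := ereal_sup (0%E |` S).

Definition boundary D : set 'rV[R]_n := closure D `\` interior D.

End domain_conditions.

(* Main.v *)
Require Import Defs.
From mathcomp Require Import all_boot all_order all_algebra.
From mathcomp Require Import all_classical all_reals all_analysis.
From mathcomp Require Import complex.
From mathcomp Require Import measurable_realfun ring lra.

Set Implicit Arguments.
Unset Strict Implicit.
Unset Printing Implicit Defensive.

Import Order.TTheory GRing.Theory Num.Theory.
Import numFieldTopology.Exports numFieldNormedType.Exports.

Local Open Scope classical_set_scope.
Local Open Scope ring_scope.

(* Kuran's argument. Let [r0] be the distance from 0 to the complement of
   [Omega]; [r0 < 1] because the unit ball has infinite measure. Let [z] be a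
   point outside the closure of [Omega] with [|z|] close to [r0] (it exists by
   (iv)). With [t(x) = |x - z|^2 / ((1 - |x|^2)(1 - |z|^2))], the squared
   hyperbolic sine of half the distance from [x] to [z], and
   [g'(t) = - (t + t^2)^(- n / 2)], both the Green function [g(t(x))] and its
   radial derivative with respect to the pole are H-harmonic off [z]. For a
   suitable [a], the function [F = a g(t) + z . grad_z g(t)] satisfies
   [F - F(0) >= delta > 0] wherever [|x| >= |z|], and
   [F - F(0) >= delta - C |x - z|^(1 - n)] elsewhere. The mean values of [F] over
   [Omega] and over (radial weights in) the ball of radius [r0] both equal
   [F(0)], so the measure of [Omega] minus this ball is at most [C / delta] times
   the integral of [|x - z|^(1 - n)] over a thin spherical shell, which tends to
   [0] as [|z|] tends to [r0]. *)

(** * The Euclidean norm *)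

(** In Euclidean space of dimension [n > 2] a combination of the Newtonian kernel and its radial
    derivative in the pole is exactly [(|x|^2 - |z|^2) / |x - z|^n], whose sign tells on which side
    of the sphere [|x| = |z|] the point lies. The hyperbolic combination does not collapse in this
    way: besides the factor that changes sign there remains a function of [t] alone, and the free
    constant [a] is spent on making that function minimal at the value of [t] at the origin. The
    ball is never cut off sharply: it is replaced by continuous radial weights supported strictly
    inside it, hence away from the pole. For these the mean value property follows from the
    vanishing of integrals of partial derivatives of compactly supported functions, with neither
    surface measure nor spherical means; the layer lost by the cutoff is absorbed into the thin
    shell. The gap must not degenerate as the pole approaches the ball, so all constants are bounded
    in terms of [r0] before [z] is chosen. *)

Section enorm_theory.
Context {R : realType} {n : nat}.
Implicit Types x y z : 'rV[R]_n.

Lemma dotp_ge0 x : 0 <= dotp x x.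
Proof. by apply: sumr_ge0 => i _; rewrite -expr2 sqr_ge0. Qed.

Lemma enorm_ge0 x : 0 <= enorm x.
Proof. exact: sqrtr_ge0. Qed.

Lemma sqr_enorm x : enorm x ^+ 2 = dotp x x.
Proof. by rewrite sqr_sqrtr// dotp_ge0. Qed.

Lemma dotpC x y : dotp x y = dotp y x.
Proof. by apply: eq_bigr => i _; rewrite mulrC. Qed.

Lemma dotpBl x y z : dotp (x - y) z = dotp x z - dotp y z.
Proof. by rewrite -sumrB; apply: eq_bigr => i _; rewrite !mxE mulrBl. Qed.

Lemma dotpZl a x y : dotp (a *: x) y = a * dotp x y.
Proof. by rewrite mulr_sumr; apply: eq_bigr => i _; rewrite mxE mulrA. Qed.

Lemma dotpZr a x y : dotp x (a *: y) = a * dotp x y.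
Proof. by rewrite dotpC dotpZl dotpC. Qed.

Lemma dotpBB x y : dotp (x - y) (x - y) = dotp x x - 2 * dotp x y + dotp y y.
Proof.
by rewrite dotpBl dotpC dotpBl (dotpC y (x - y)) dotpBl (dotpC y x); ring.
Qed.

Lemma enorm0 : enorm (0 : 'rV[R]_n) = 0.
Proof. by rewrite /enorm /dotp big1 ?sqrtr0// => i _; rewrite mxE mul0r. Qed.

Lemma enormN x : enorm (- x) = enorm x.
Proof.
by congr Num.sqrt; apply: eq_bigr => i _; rewrite mxE mulrNN.
Qed.

Lemma enormBC x y : enorm (x - y) = enorm (y - x).
Proof. by rewrite -enormN opprB. Qed.

Lemma coord_le_enorm x i : `|x ord0 i| <= enorm x.
Proof.
rewrite -sqrtr_sqr ler_sqrt ?dotp_ge0// /dotp (bigD1 i)//= -expr2 lerDl.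
by apply: sumr_ge0 => j _; rewrite -expr2 sqr_ge0.
Qed.

Lemma rV_norm_leP x r : 0 <= r ->
  reflect (forall i, `|x ord0 i| <= r) (`|x| <= r).
Proof.
move=> r0; rewrite [X in reflect _ (X <= _)]/Num.norm/= mx_normrE.
apply: (iffP idP) => [/bigmax_leP[_ H] i|H]; first exact: (H (ord0, i)).
apply/bigmax_leP.
by split=> // -[i j] _ /=; rewrite (_ : i = ord0)//; exact: ord1.
Qed.

Lemma norm_le_enorm x : `|x| <= enorm x.
Proof.
by apply/rV_norm_leP => [|i]; [exact: enorm_ge0|exact: coord_le_enorm].
Qed.

Lemma coord_le_norm x i : `|x ord0 i| <= `|x|.
Proof. by move: i; exact/rV_norm_leP. Qed.

Lemma enorm_eq0 x : (enorm x == 0) = (x == 0).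
Proof.
apply/idP/eqP => [/eqP e0|->]; last by rewrite enorm0.
by apply/eqP; rewrite -normr_le0 -e0 norm_le_enorm.
Qed.

Lemma enorm_gt0 x : (0 < enorm x) = (x != 0).
Proof. by rewrite lt_def enorm_ge0 andbT enorm_eq0. Qed.

Lemma enorm_le_norm x : enorm x <= n%:R * `|x|.
Proof.
rewrite -[leRHS]ger0_norm ?mulr_ge0// -sqrtr_sqr ler_sqrt ?sqr_ge0//.
apply: (@le_trans _ _ (\sum_(i < n) `|x| ^+ 2)).
  apply: ler_sum => i _; rewrite -expr2 -real_normK ?num_real//.
  by rewrite ler_pXn2r ?nnegrE// coord_le_norm.
rewrite sumr_const card_ord -[leLHS]mulr_natl exprMn ler_wpM2r ?sqr_ge0//.
by rewrite -natrX ler_nat; case: n => // m; rewrite expnS expn1 leq_pmulr.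
Qed.

(** Cauchy-Schwarz, from the nonnegative square of [enorm y *: x - enorm x *: y]; zero vectors are
    set apart because the expansion is divided by [enorm x * enorm y]. *)
Lemma dotp_le x y : dotp x y <= enorm x * enorm y.
Proof.
have [->|x0] := eqVneq x 0.
  by rewrite enorm0 mul0r /dotp big1// => i _; rewrite mxE mul0r.
have [->|y0] := eqVneq y 0.
  by rewrite enorm0 mulr0 /dotp big1// => i _; rewrite mxE mulr0.
have := dotp_ge0 (enorm y *: x - enorm x *: y).
rewrite dotpBB !dotpZl !dotpZr -!sqr_enorm.
have a0 : 0 < enorm x by rewrite enorm_gt0.
have b0 : 0 < enorm y by rewrite enorm_gt0.
set a := enorm x; set b := enorm y; set d := dotp x y.
have -> : b * (b * a ^+ 2) - 2 * (b * (a * d)) + a * (a * b ^+ 2) =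
  (a * b * 2) * (a * b - d) by ring.
by rewrite pmulr_rge0 ?subr_ge0// !mulr_gt0.
Qed.

Lemma enorm_triangle x y : enorm (x - y) <= enorm x + enorm y.
Proof.
rewrite -[leRHS]ger0_norm ?addr_ge0 ?enorm_ge0// -sqrtr_sqr ler_sqrt ?sqr_ge0//.
rewrite dotpBB -!sqr_enorm.
have := dotp_le (- x) y; rewrite enormN -scaleN1r dotpZl => h.
nra.
Qed.

Lemma enormB_ge x y : enorm x - enorm y <= enorm (x - y).
Proof.
have := enorm_triangle (x - y) (- y); rewrite opprK subrK enormN.
by rewrite -lerBlDr.
Qed.

Lemma continuous_coord i : continuous (fun x : 'rV[R]_n => x ord0 i).
Proof. exact: coord_continuous. Qed.

Lemma continuous_sumr (I : Type) (r : seq I) (T : topologicalType)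
    (f : I -> T -> R) (x : T) :
  (forall i, {for x, continuous (f i)}) ->
  {for x, continuous (fun t => \sum_(i <- r) f i t)}.
Proof.
move=> cf; elim: r => [|i r ih].
  rewrite (_ : (fun _ => _) = cst 0); first exact: cst_continuous.
  by apply/funext => t; rewrite big_nil.
rewrite (_ : (fun _ => _) = (fun t => f i t + \sum_(j <- r) f j t)).
  by apply: continuousD; [exact: cf|exact: ih].
by apply/funext => t; rewrite big_cons.
Qed.

Lemma continuous_dotpB z :
  continuous (fun x => dotp (x - z) (x - z)).
Proof.
move=> x; apply: continuous_sumr => i.
have c : {for x, continuous (fun t : 'rV[R]_n => (t - z) ord0 i)}.
  rewrite (_ : (fun _ => _) = (fun t : 'rV[R]_n => t ord0 i - z ord0 i)).
    by apply: continuousB; [exact: continuous_coord|exact: cst_continuous].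
  by apply/funext => t; rewrite !mxE.
by apply: continuousM.
Qed.

Lemma continuous_enormB z : continuous (fun x => enorm (x - z)).
Proof.
move=> x; apply: (@continuous_comp _ _ _ (fun x => dotp (x - z) (x - z)) (@Num.sqrt R)).
  exact: continuous_dotpB.
exact: sqrt_continuous.
Qed.

Lemma continuous_dotp : continuous (fun x => dotp x x).
Proof.
move=> x; have := @continuous_dotpB 0 x.
by under eq_fun do rewrite subr0.
Qed.

Lemma continuous_enorm : continuous (@enorm R n).
Proof.
move=> x; have := @continuous_enormB 0 x.
by under eq_fun do rewrite subr0.
Qed.

Lemma open_enorm_lt r : open [set x : 'rV[R]_n | enorm x < r].
Proof.
apply: (@open_comp _ _ (@enorm R n) [set t | t < r]); last exact: open_lt.
by move=> x _; exact: continuous_enorm.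
Qed.

Lemma open_enorm_gt r : open [set x : 'rV[R]_n | r < enorm x].
Proof.
apply: (@open_comp _ _ (@enorm R n) [set t | r < t]); last exact: open_gt.
by move=> x _; exact: continuous_enorm.
Qed.

End enorm_theory.
(** * Lebesgue measure on row vectors *)

(** [ball] belongs to the sup norm, so it is an open cube, the shape that the coordinate
    sigma-algebra and the product measure handle directly. *)
Lemma ball_rVE (R : realType) n (z : 'rV[R]_n) r : 0 < r ->
  ball z r = \bigcap_(i in [set: 'I_n]) [set x | `|z ord0 i - x ord0 i| < r].
Proof.
move=> r0; apply/seteqP; split=> [x [_ zx] i _ /=|x zx].
  exact: zx.
by split=> // i j; rewrite (ord1 i); exact: zx.
Qed.

Lemma measurable_ball_rV (R : realType) n (z : 'rV[R]_n) r :
  measurable (ball z r).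
Proof.
have [r0|r0] := ltP 0 r; last first.
  rewrite (_ : ball z r = set0) // -subset0 => x [].
  by rewrite ltNge r0.
rewrite ball_rVE//; apply: fin_bigcap_measurable; first exact: finite_finset.
move=> i _.
have := @measurable_rV_coord R n i measurableT _ (measurable_ball (z ord0 i) r).
by rewrite setTI.
Qed.

(** Second countability: [U] is the union of the cubes inside it with rational centre and radius
    [m.+1%:R^-1], and cubes are measurable for the coordinate sigma-algebra. *)
Lemma open_measurable_rV (R : realType) n (U : set 'rV[R]_n) :
  open U -> measurable U.
Proof.
move=> oU.
pose qv (q : 'rV[rat]_n) : 'rV[R]_n := map_mx ratr q.
pose F k := if unpickle k is Some (q, m) then
    if `[< ball (qv q) (m.+1%:R^-1) `<=` U >] then ball (qv q) (m.+1%:R^-1)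
    else set0
  else set0.
rewrite (_ : U = \bigcup_k F k).
  apply: bigcup_measurable => k _; rewrite /F.
  case: unpickle => [[q m]|//]; case: ifP => // _.
  exact: measurable_ball_rV.
apply/seteqP; split=> [x Ux|x [k _]]; last first.
  by rewrite /F; case: unpickle => [[q m]|//]; case: ifPn => // /asboolP; exact.
have /nbhs_ballP[e /= e0 xeU] : nbhs x U by exact: oU.
(* A radius below [e / 2] suffices: if [x] lies in the rational cube, every point of that cube is
   within twice the radius of [x]. *)
have [m me] : exists m : nat, m.+1%:R^-1 < e / 2.
  have e20 : 0 < e / 2 by rewrite divr_gt0.
  have [m _ /(_ _ (leqnn m)) /=] := near_infty_natSinv_lt (PosNum e20).
  by exists m.
have m0 : (0 : R) < m.+1%:R^-1 by rewrite invr_gt0.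
have /choice[q qP] : forall i, exists a : rat,
    x ord0 i - m.+1%:R^-1 < ratr a < x ord0 i + m.+1%:R^-1.
  move=> i; have xx : x ord0 i - m.+1%:R^-1 < x ord0 i + m.+1%:R^-1.
    by rewrite ltrBlDr -addrA ltrDl addr_gt0.
  have [a] := rat_in_itvoo xx.
  by rewrite in_itv/=; exists a.
pose v : 'rV[rat]_n := \row_i q i.
have vx : ball (qv v) (m.+1%:R^-1) x.
  split=> // i j; have -> : i = ord0 by exact: ord1.
  rewrite /ball /= !mxE.
  have := qP j; set a := ratr _; set b := _^-1; move: a b => a b /andP[h1 h2].
  by rewrite ltr_norml; apply/andP; split; lra.
exists (pickle (v, m)) => //; rewrite /F pickleK ifT//.
apply/asboolP => y vy; apply: xeU; apply: (@le_ball _ _ _ (m.+1%:R^-1 + m.+1%:R^-1)).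
  by rewrite (splitr e) lerD// ltW.
by apply: ball_triangle vy; exact: ball_sym.
Qed.

Lemma closed_measurable_rV (R : realType) n (U : set 'rV[R]_n) :
  closed U -> measurable U.
Proof.
move=> cU; rewrite -(setCK U); apply: measurableC.
by apply: open_measurable_rV; exact: closed_openC.
Qed.

Lemma continuous_measurable_rV (R : realType) n (U : set 'rV[R]_n)
    (f : 'rV[R]_n -> R) :
  open U -> (forall x, U x -> {for x, continuous f}) -> measurable_fun U f.
Proof.
move=> oU cf; apply: (measurability _ (RGenOpens.measurableE R)).
move=> _ [_ [a [b ->] <-]].
apply: open_measurable_rV; rewrite openE => x [Ux abfx].
rewrite /interior; apply: filterI; first exact: oU.
apply: cf => //; exact: open_nbhs_nbhs.
Qed.

Lemma lebesgue_rV_ball (R : realType) n (z : 'rV[R]_n) r : 0 < r ->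
  lebesgue_rV R n (ball z r) = ((2 * r) ^+ n)%:E.
Proof.
move=> r0; elim: n z => [|n ih] z.
  rewrite /= diracE mem_set ?expr0//; split=> // i [].
  by [].
rewrite /= /lebesgue_step /pushforward.
rewrite (_ : _ @^-1` _ = ball (z ord0 ord0) r `*` ball (\row_j z ord0 (rshift 1 j)) r).
  rewrite product_measure1E//=; [|exact: measurable_ball|exact: measurable_ball_rV].
  by rewrite ih lebesgue_measure_ball ?ltW// -EFinM exprS mulr_natl.
apply/seteqP; split=> [[a v] [_ H]|[a v] [/= za [_ zv]]] /=.
  split => /=.
    have := H ord0 ord0; rewrite /rV_cons /=.
    by rewrite (_ : ord0 = lshift n (ord0 : 'I_1)) ?(@row_mxEl _ 1 1 n) ?mxE//; exact: val_inj.
  split=> // i j; rewrite (ord1 i) mxE; have := H ord0 (rshift 1 j).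
  by rewrite /rV_cons /= (@row_mxEr _ 1 1 n).
split => // i j; rewrite (ord1 i) /rV_cons /=.
case: (@split_ordP 1 n j) => k ->.
  rewrite (@row_mxEl _ 1 1 n) (ord1 k) !mxE eqxx mulr1n.
  by rewrite (_ : lshift n ord0 = ord0)//; exact: val_inj.
by rewrite (@row_mxEr _ 1 1 n); have := zv ord0 k; rewrite mxE.
Qed.
(** Fubini along the first coordinate: once the others are fixed, it satisfies [a ^+ 2 = c], which
    leaves at most two points. *)
Lemma lebesgue_rV_sphere (R : realType) n (r : R) : (0 < n)%N ->
  lebesgue_rV R n [set x | enorm x = r] = 0%E.
Proof.
case: n => // n _.
pose S := [set x : 'rV[R]_n.+1 | enorm x = r].
have mS : measurable S.
  apply: closed_measurable_rV.
  apply: (@closed_comp _ _ (@enorm R n.+1) [set r]); last exact: closed_eq.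
  by move=> x _; exact: continuous_enorm.
have mcS : measurable (@rV_cons R n @^-1` S).
  by rewrite -[X in measurable X]setTI; exact: measurable_rV_cons.
rewrite /= /lebesgue_step /pushforward /product_measure1.
have := @indic_fubini_tonelli _ _ _ _ R lebesgue_measure (lebesgue_rV R n) _ mcS.
rewrite (indic_fubini_tonelli_FE _ mcS) => ->. rewrite (indic_fubini_tonelli_GE _ mcS).
apply: integral0_eq => v _ /=.
have [c hc] : exists c, ysection (@rV_cons R n @^-1` S) v `<=` [set a | a ^+ 2 = c].
  exists (r ^+ 2 - dotp v v) => a; rewrite /ysection /= inE /S /= => <-.
  rewrite sqr_enorm /dotp (@big_split_ord _ _ _ 1 n)/= big_ord1.
  rewrite /rV_cons /= (@row_mxEl _ 1 1 n) !mxE eqxx mulr1n -expr2.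
  rewrite [X in _ + X - _](_ : _ = dotp v v) ?addrK//.
  by apply: eq_bigr => i _; rewrite (@row_mxEr _ 1 1 n).
apply: (@subset_measure0 _ _ R lebesgue_measure _
  ([set Num.sqrt c; - Num.sqrt c] : set (measurableTypeR R))).
- exact: measurable_ysection.
- by apply: measurableU; exact: measurable_set1.
- move=> a /hc /= <-; rewrite sqrtr_sqr.
  by case: (ger0P a) => _; [left|right; rewrite opprK].
- by apply: countable_lebesgue_measure0; exact: finite_set_countable.
Qed.

Lemma measurable_potential (R : realType) n (z : 'rV[R]_n) k :
  measurable_fun setT (fun x : 'rV[R]_n => enorm (x - z) ^- k).
Proof.
rewrite (_ : (fun x => _) = (fun x => enorm (x - z) `^ (- k%:R))); last first.
  by apply/funext => x; rewrite powRN powR_mulrn// enorm_ge0.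
apply: (measurableT_comp (measurable_powR _)).
apply: continuous_measurable_rV => [|x _]; first exact: openT.
exact: continuous_enormB.
Qed.

(** Dyadic decomposition: on [F j] the kernel is at most [(eta / 2 ^ (j+1)) ^ (1 - n)] and the
    volume at most [(4 eta / 2 ^ (j+1)) ^ n], so that [F j] contributes at most
    [4 ^ n eta / 2 ^ (j+1)], a geometric series. *)
Lemma potential_ball_le (R : realType) n (z : 'rV[R]_n) eta :
  (1 < n)%N -> 0 < eta ->
  (\int[lebesgue_rV R n]_(x in ball z eta) (enorm (x - z) ^- n.-1)%:E <=
    (4 ^+ n * eta)%:E)%E.
Proof.
move=> n1 eta0.
pose B j : set 'rV[R]_n := ball z (eta / 2 ^+ j).
pose F j := B j `\` B j.+1.
have ndB i j : (i <= j)%N -> B j `<=` B i.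
  move=> ij; apply: le_ball; rewrite ler_pM2l// lef_pV2 ?posrE ?exprn_gt0//.
  by rewrite ler_weXn2l// ler1n.
have mF j : measurable (F j) by apply: measurableD; exact: measurable_ball_rV.
have pot0 (x : 'rV[R]_n) : (0 <= (enorm (x - z) ^- n.-1)%:E)%E.
  by rewrite lee_fin invr_ge0 exprn_ge0// enorm_ge0.
have mpot D : measurable_fun D (fun x : 'rV[R]_n => (enorm (x - z) ^- n.-1)%:E).
  by apply/measurable_EFinP; apply: measurable_funTS; exact: measurable_potential.
have tF : trivIset setT F.
  apply: ltn_trivIset => i j ij; apply/seteqP; split=> // x [[_ xi] [xj _]].
  exact/xi/(ndB _ _ ij).
have UF : ball z eta `\ z `<=` \bigcup_j F j.
  move=> x [zx xz].
  have xz0 : 0 < `|z - x| by rewrite normr_gt0 subr_eq0 eq_sym; apply/eqP.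
  have [j Hj] : exists j, ~ B j x.
    have [j hj] : exists j, eta / `|z - x| < 2 ^+ j.
      exists (Num.bound (eta / `|z - x|)).
      apply: lt_le_trans (archi_boundP _) _; first by rewrite divr_ge0// ltW.
      by rewrite -natrX ler_nat ltnW// ltn_expl.
    exists j; rewrite /B -ball_normE /=; apply/negP; rewrite -leNgt.
    by rewrite ler_pdivrMr ?exprn_gt0// mulrC -ler_pdivrMr// ltW.
  have ex : exists j, `[< ~ B j x >] by exists j; apply/asboolP.
  case: (ex_minnP ex) => -[|m] /asboolP hm hmin.
    by exfalso; apply: hm; rewrite /B expr0 divr1.
  exists m => //; split => //; apply: contrapT => nBm.
  have /hmin : `[< ~ B m x >] by apply/asboolP.
  by rewrite ltnn.
apply: (@le_trans _ _ (\int[lebesgue_rV R n]_(x in \bigcup_j F j) (enorm (x - z) ^- n.-1)%:E)%E).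
  rewrite integral_mkcond [leRHS]integral_mkcond.
  apply: ge0_le_integral => //.
  - by move=> x _; apply: erestrict_ge0.
  - by apply/(measurable_restrictT _ (measurable_ball_rV _ _)); exact: mpot.
  - apply/(measurable_restrictT _ (bigcup_measurable (fun j _ => mF j))); exact: mpot.
  - move=> x _; rewrite /patch; case: ifPn => [|_]; last by case: ifPn.
    (* The centre [z] lies in no [F j]; there the integrand is [0], since [0^-1 = 0] and
       [n - 1 > 0]. *)
    rewrite inE => xB; have [->|/eqP xz] := eqVneq x z.
      rewrite subrr enorm0 expr0n -subn1 subn_eq0 leqNgt n1/= invr0.
      by case: ifPn.
    by rewrite mem_set//; apply: UF.
rewrite ge0_integral_bigcup//.
apply: (@le_trans _ _ (\sum_(j <oo) ((4 ^+ n * eta) / (2 ^ j.+1)%:R)%:E)%E); last first.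
  by apply: epsilon_trick0; rewrite mulr_ge0 ?exprn_ge0 ?ltW.
apply: lee_nneseries => [j _ _|j _]; first exact: integral_ge0.
have bj : 0 < eta / 2 ^+ j by rewrite divr_gt0// exprn_gt0.
have bj1 : 0 < eta / 2 ^+ j.+1 by rewrite divr_gt0// exprn_gt0.
apply: (@le_trans _ _ (\int[lebesgue_rV R n]_(x in F j) cst ((eta / 2 ^+ j.+1) ^- n.-1)%:E x)%E).
  apply: ge0_le_integral => //= x [_ xB].
  - rewrite lee_fin lef_pV2 ?posrE ?exprn_gt0//.
      apply: lerXn2r; rewrite ?nnegrE ?enorm_ge0 ?(ltW bj1)//.
      move: xB; rewrite /B -ball_normE/= => /negP; rewrite -leNgt.
      by move/le_trans; apply; rewrite distrC norm_le_enorm.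
    rewrite enorm_gt0 subr_eq0; apply/eqP => xz; apply: xB; rewrite xz.
    exact: ballxx.
rewrite integral_cst//.
apply: (@le_trans _ _ (((eta / 2 ^+ j.+1) ^- n.-1)%:E * ((2 * (eta / 2 ^+ j)) ^+ n)%:E)%E).
  apply: lee_wpmul2l; first by rewrite lee_fin invr_ge0 exprn_ge0// ltW.
  rewrite -(lebesgue_rV_ball z)//; apply: le_measure; rewrite ?inE//.
    exact: measurable_ball_rV.
  by move=> x [].
rewrite -EFinM lee_fin le_eqVlt; apply/orP; left; apply/eqP.
have -> : 2 * (eta / 2 ^+ j) = 4 * (eta / 2 ^+ j.+1).
  by rewrite exprS; field; rewrite expf_neq0.
rewrite natrX -[RHS]mulrA; set q := eta / _.
have -> : (4 * q) ^+ n = 4 ^+ n * (q ^+ n.-1 * q).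
  by rewrite -exprSr prednK ?exprMn// ltnW.
by rewrite mulrCA mulKf// expf_neq0// gt_eqF.
Qed.

(** * Integrals of compactly supported functions and of their derivatives *)

Lemma bounded_supp_integrable d (T : measurableType d) (R : realType)
    (mu : {measure set T -> \bar R}) (A : set T) (G : T -> R) C :
  measurable A -> (mu A < +oo)%E -> measurable_fun A G ->
  (forall x, A x -> `|G x| <= C) -> (forall x, ~ A x -> G x = 0) ->
  mu.-integrable setT (EFin \o G).
Proof.
move=> mA muA mG GC G0.
have -> : EFin \o G = (EFin \o G) \_ A.
  apply/funext => x; rewrite /patch; case: ifPn => //.
  by rewrite notin_setE => /G0 /= ->.
apply/(integrable_mkcond _ mA).
apply: measurable_bounded_integrable => //.
by exists C; split; [exact: num_real|move=> D CD x Ax; exact: le_trans (GC _ Ax) (ltW CD)].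
Qed.

Lemma is_derive_line (R : realType) (V : normedModType R) (F : V -> R)
    (x v : V) t d :
  is_derive (x + t *: v) v F d -> is_derive t 1 (fun s => F (x + s *: v)) d.
Proof.
have E : (fun h : R => h^-1 *: (((fun s => F (x + s *: v)) \o shift t) (h *: 1) - F (x + t *: v)))
   = (fun h => h^-1 *: ((F \o shift (x + t *: v)) (h *: v) - F (x + t *: v))).
  apply/funext => h; congr (_ *: (F _ - _)).
  by rewrite /= [h *: 1]mulr1 scalerDl addrCA.
move=> [dF Fd]; split; first by rewrite /derivable E.
by rewrite -Fd /derive E.
Qed.

Lemma continuous_ball_bounded (R : realType) n (G : 'rV[R]_n -> R) M :
  continuous G -> exists C, forall x, ball (0 : 'rV[R]_n) M x -> `|G x| <= C.
Proof.
move=> cG.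
have cK : compact [set x : 'rV[R]_n | `|x| <= M].
  apply: bounded_closed_compact.
    by exists M; split; [exact: num_real|move=> D MD x /= /le_trans; apply; exact: ltW].
  apply: (@closed_comp _ _ (fun x : 'rV[R]_n => `|x|) [set r | r <= M]); last exact: closed_le.
  by move=> x _; exact: norm_continuous.
have [C [_ hC]] : bounded_set (G @` [set x : 'rV[R]_n | `|x| <= M]).
  apply: compact_bounded; apply: continuous_compact => //.
  exact: continuous_subspaceT.
exists (`|C| + 1) => x; rewrite -ball_normE /= sub0r normrN => xM.
apply: hC; first by rewrite (le_lt_trans (ler_norm _))// ltrDl.
by exists x => //; rewrite /= ltW.
Qed.
Lemma continuous_supp_integrable (R : realType) n (G : 'rV[R]_n -> R) M :
  0 < M -> continuous G -> (forall x, ~ ball (0 : 'rV[R]_n) M x -> G x = 0) ->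
  (lebesgue_rV R n).-integrable setT (EFin \o G).
Proof.
move=> M0 cG G0; have [C GC] := continuous_ball_bounded M cG.
apply: (@bounded_supp_integrable _ _ R _ (ball (0 : 'rV[R]_n) M) G C) => //.
- exact: measurable_ball_rV.
- apply: le_lt_trans (ltry ((2 * M) ^+ n)); rewrite le_eqVlt; apply/orP; left.
  apply/eqP; exact: lebesgue_rV_ball.
- apply: measurable_funTS; apply: continuous_measurable_rV => [|x _].
    exact: openT.
  exact: cG.
Qed.

(** The fundamental theorem of calculus on [[- M, M]], at both ends of which [F] vanishes. *)
Lemma integral_derive_supp (R : realType) (F G : R -> R) (M : R) : 0 < M ->
  (forall t : R, is_derive t (1 : R) F (G t)) -> continuous G ->
  (forall t, M <= `|t| -> F t = 0) -> (forall t, M <= `|t| -> G t = 0) ->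
  (\int[lebesgue_measure]_t (G t)%:E)%E = 0%E.
Proof.
move=> M0 dF cG F0 G0.
have cF : continuous F.
  move=> t; apply: differentiable_continuous; apply/derivable1_diffP.
  by have [] := dF t.
transitivity (\int[lebesgue_measure]_(t in [set` `[- M, M]%R]) (G t)%:E)%E.
  rewrite [RHS]integral_mkcond; apply: eq_integral => t _.
  rewrite /patch; case: ifPn => //; rewrite notin_setE /= in_itv /= => /negP tM.
  by rewrite G0// leNgt; apply: contra tM => /ltW; rewrite ler_norml.
rewrite (@continuous_FTC2 _ _ F).
- by rewrite !F0 ?subee// ?normrN ger0_norm// ltW.
- lra.
- exact: continuous_subspaceT.
- split=> [t _|//|//]; first by have [] := dF t.
    by apply: cvg_at_right_filter; exact: cF.
  by apply: cvg_at_left_filter; exact: cF.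
- by move=> t _; rewrite derive1E; have [_] := dF t.
Qed.

Lemma rV_consE (R : realType) n (a : R) (v : 'rV[R]_n) :
  (forall i, rV_cons (a, v) ord0 (rshift 1 i) = v ord0 i) *
  (rV_cons (a, v) ord0 ord0 = a).
Proof.
split=> [i|]; first by rewrite /rV_cons (@row_mxEr _ 1 1 n).
have -> : (ord0 : 'I_n.+1) = lshift n (ord0 : 'I_1) by exact: val_inj.
by rewrite /rV_cons (@row_mxEl _ 1 1 n) !mxE eqxx.
Qed.

Lemma rV_cons_eqP (R : realType) n (a : R) (v : 'rV[R]_n) (w : 'rV[R]_n.+1) :
  w ord0 ord0 = a -> (forall i, w ord0 (rshift 1 i) = v ord0 i) ->
  w = rV_cons (a, v).
Proof.
move=> w0 wS; apply/rowP => i; case: (@split_ordP 1 n i) => k ->.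
  have -> : lshift n k = ord0 :> 'I_n.+1 by rewrite (ord1 k); exact: val_inj.
  by rewrite rV_consE.
by rewrite rV_consE.
Qed.

Lemma rV_cons_affine (R : realType) n (a h : R) (v w : 'rV[R]_n) c :
  rV_cons (c, w) + h *: rV_cons (a, v) = rV_cons (c + h * a, w + h *: v).
Proof.
by apply: rV_cons_eqP => [|i]; rewrite mxE [X in _ + X]mxE !rV_consE// mxE [in RHS]mxE.
Qed.

Lemma rV_cons_delta (R : realType) n :
  (delta_mx ord0 ord0 = rV_cons (1, 0) :> 'rV[R]_n.+1) *
  (forall i, delta_mx ord0 (rshift 1 i) = rV_cons (0, delta_mx ord0 i) :> 'rV[R]_n.+1).
Proof.
by split=> [|j]; apply: rV_cons_eqP => [|i]; rewrite !mxE ?eqxx.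
Qed.

Lemma ball_rV_cons (R : realType) n M a (v : 'rV[R]_n) :
  ball (0 : 'rV[R]_n.+1) M (rV_cons (a, v)) -> `|a| < M /\ ball (0 : 'rV[R]_n) M v.
Proof.
move=> [M0 H]; split.
  by have := H ord0 ord0; rewrite mxE /ball /= rV_consE sub0r normrN.
split=> // i j; have -> : i = ord0 by exact: ord1.
by have := H ord0 (rshift 1 j); rewrite rV_consE [X in ball X]mxE [X in _ -> ball X _ _]mxE.
Qed.

Lemma continuous_rV_cons (R : realType) n :
  (forall v, continuous (fun a : R => rV_cons (a, v : 'rV[R]_n))) *
  (forall a, continuous (fun v : 'rV[R]_n => rV_cons (a : R, v))).
Proof.
split=> [v a|a v].
  apply/(@cvg_ballP _ _ _ (nbhs (a : R)) (nbhs_filter a)) => e e0.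
  near=> b; split=> // i j; have -> : i = ord0 by exact: ord1.
  case: (@split_ordP 1 n j) => k ->.
    have -> : lshift n k = ord0 :> 'I_n.+1 by rewrite (ord1 k); exact: val_inj.
    rewrite !rV_consE; near: b; exact: nbhsx_ballx.
  by rewrite !rV_consE; exact: ballxx.
have FF : Filter (nbhs (v : 'rV[R]_n)) by exact: nbhs_filter.
apply/(@cvg_ballP _ _ _ (nbhs (v : 'rV[R]_n)) FF) => e e0.
near=> w; split=> // i j; have -> : i = ord0 by exact: ord1.
case: (@split_ordP 1 n j) => k ->.
  have -> : lshift n k = ord0 :> 'I_n.+1 by rewrite (ord1 k); exact: val_inj.
  by rewrite !rV_consE; exact: ballxx.
rewrite !rV_consE.
suff [_ H] : ball v e w by exact: H.
by near: w; exact: nbhsx_ballx.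
Unshelve. all: by end_near. Qed.

(** Induction on the dimension by Fubini. For the first coordinate the one-dimensional inner
    integral vanishes; for any other coordinate the first one is frozen and the induction hypothesis
    applies to the remaining ones. *)
Lemma integral_partial0 (R : realType) n (i : 'I_n) (F G : 'rV[R]_n -> R) M :
  0 < M -> (forall x, is_derive x (delta_mx ord0 i) F (G x)) -> continuous G ->
  (forall x, ~ ball (0 : 'rV[R]_n) M x -> F x = 0) ->
  (forall x, ~ ball (0 : 'rV[R]_n) M x -> G x = 0) ->
  (\int[lebesgue_rV R n]_x (G x)%:E)%E = 0%E.
Proof.
move=> M0; elim: n i F G => [[]//|n ih] i F G dF cG F0 G0.
have iG : (lebesgue_measure \x lebesgue_rV R n)%E.-integrable setT
    (fun p => (G (rV_cons p))%:E).
  have [C GC] := continuous_ball_bounded M cG.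
  apply: (@bounded_supp_integrable _ _ R _
    ((ball (0 : R) M : set (measurableTypeR R)) `*`
     (ball (0 : 'rV[R]_n) M : set 'rV[R]_n)) (fun p => G (rV_cons p)) C).
  - by apply: measurableX; [exact: measurable_ball|exact: measurable_ball_rV].
  - have e := @product_measure1E _ _ _ _ R lebesgue_measure (lebesgue_rV R n) _ _
      (measurable_ball (0 : R) M) (measurable_ball_rV (0 : 'rV[R]_n) M).
    apply: le_lt_trans (ltry (M *+ 2 * (2 * M) ^+ n)); rewrite le_eqVlt.
    apply/orP; left; apply/eqP; etransitivity; first exact: e.
    rewrite EFinM; congr (_ * _)%E; last exact: lebesgue_rV_ball.
    exact: lebesgue_measure_ball (ltW M0).
  - apply: measurable_funTS.
    apply: measurableT_comp (@measurable_rV_cons R n).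
    by apply: continuous_measurable_rV => [|x _]; [exact: openT|exact: cG].
  - move=> [a v] _; have [/GC//|/G0 ->] := pselect (ball 0 M (rV_cons (a, v))).
    rewrite normr0; apply: le_trans (GC 0 _) => //; exact: ballxx.
  - move=> [a v] av; apply: G0 => /ball_rV_cons[aM vM]; apply: av; split=> //.
    by rewrite -ball_normE/= sub0r normrN.
rewrite /= /lebesgue_step integral_pushforward//=; last 2 first.
  - exact: measurable_rV_cons.
  - apply/measurable_EFinP; apply: continuous_measurable_rV => [|x _].
      exact: openT.
    exact: cG.
rewrite preimage_setT.
case: (@split_ordP 1 n i) => k ik.
  rewrite -integral21_prod_meas1//; apply: integral0_eq => v _.
  rewrite /fubini_G.
  apply: (@integral_derive_supp _ (fun a => F (rV_cons (a, v))) _ M) => //.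
  - move=> t.
    have -> : (fun a => F (rV_cons (a, v))) =
        fun s => F (rV_cons (0, v) + s *: rV_cons (1, 0)).
      by apply/funext => s; rewrite rV_cons_affine scaler0 addr0 add0r mulr1.
    apply: is_derive_line; rewrite rV_cons_affine scaler0 addr0 add0r mulr1.
    have := dF (rV_cons (t, v)); rewrite ik (ord1 k).
    have -> : lshift n (ord0 : 'I_1) = ord0 :> 'I_n.+1 by exact: val_inj.
    by rewrite rV_cons_delta.
  - move=> a; apply: continuous_comp; last exact: cG.
    exact: (continuous_rV_cons R n).1.
  - by move=> t tM; apply: F0 => /ball_rV_cons[]; rewrite ltNge tM.
  - by move=> t tM; apply: G0 => /ball_rV_cons[]; rewrite ltNge tM.
rewrite -integral12_prod_meas1//; apply: integral0_eq => a _.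
rewrite /fubini_F.
apply: (ih k (fun v => F (rV_cons (a, v))) (fun v => G (rV_cons (a, v)))).
- move=> v; have := dF (rV_cons (a, v)); rewrite ik rV_cons_delta.
  set w := rV_cons (0, _); set e := delta_mx _ _.
  have E : (fun h : R => h^-1 *:
       (((fun v => F (rV_cons (a, v))) \o shift v) (h *: e) - F (rV_cons (a, v))))
     = (fun h => h^-1 *: ((F \o shift (rV_cons (a, v))) (h *: w) - F (rV_cons (a, v)))).
    apply/funext => h; congr (_ *: (F _ - _)).
    by rewrite /= [RHS]addrC rV_cons_affine mulr0 addr0 addrC.
  by move=> [dF' Fd']; split; [rewrite /derivable E|rewrite -Fd' /derive E].
- move=> v; apply: continuous_comp; last exact: cG.
  exact: (continuous_rV_cons R n).2.
- by move=> v vM; apply: F0 => /ball_rV_cons[_ /vM].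
- by move=> v vM; apply: G0 => /ball_rV_cons[_ /vM].
Qed.
(** * Integration against the hyperbolic density *)

Section density.
Context d (T : measurableType d) (R : realType).
Variables (mu nu' : {measure set T -> \bar R}) (D : set T) (g : T -> R).
Hypotheses (mD : measurable D) (mg : measurable_fun D g)
  (g0 : forall x, D x -> 0 <= g x)
  (nuE : forall A, measurable A -> A `<=` D ->
    nu' A = (\int[mu]_(x in A) (g x)%:E)%E).

Import HBNNSimple.

(** The density is known only for subsets of [D], so the passage from indicators to simple functions
    and monotone limits is carried out relative to [D]. *)
Lemma ge0_integral_density (f : T -> \bar R) :
  (forall x, D x -> (0 <= f x)%E) -> measurable_fun D f ->
  (\int[nu']_(x in D) f x = \int[mu]_(x in D) (f x * (g x)%:E))%E.
Proof.
move=> f0 mf.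
pose h := nnsfun_approx mD mf.
have mgE : measurable_fun D (EFin \o g) by exact/measurable_EFinP.
have -> : (\int[nu']_(x in D) f x =
    lim (\int[nu']_(x in D) (EFin \o h n) x @[n --> \oo]))%E.
  have fE x : D x -> f x = lim ((EFin \o h n) x @[n --> \oo]).
    by move=> Dx; apply/esym/cvg_lim => //; exact: cvg_nnsfun_approx.
  under eq_integral => x /[!inE] /fE -> //.
  apply: monotone_convergence => //.
  - move=> n; apply/measurable_EFinP.
    by apply: (measurable_funS measurableT) => //; exact/measurable_funP.
  - by move=> n x Dx //=; rewrite lee_fin.
  - by move=> x Dx a b ab; rewrite lee_fin; exact/lefP/nd_nnsfun_approx.
have -> : (\int[mu]_(x in D) (f x * (g x)%:E) =
    lim (\int[mu]_(x in D) ((h n x)%:E * (g x)%:E) @[n --> \oo]))%E.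
  have fg x : D x -> (f x * (g x)%:E = lim (((h n x)%:E * (g x)%:E) @[n --> \oo]))%E.
    by move=> Dx; apply/esym/cvg_lim => //; apply: cvgeZr => //;
      exact: cvg_nnsfun_approx.
  under eq_integral => x /[!inE] /fg -> //.
  apply: monotone_convergence => [//| | |].
  - move=> n; apply/emeasurable_funM => //; apply/measurable_funTS.
    exact/measurable_EFinP.
  - by move=> n x Dx /=; rewrite mule_ge0 ?lee_fin ?g0.
  - move=> x Dx a b ab/=; rewrite lee_wpmul2r ?lee_fin ?g0//.
    exact/lefP/nd_nnsfun_approx.
suff suf n : (\int[mu]_(x in D) ((h n x)%:E * (g x)%:E) =
    \int[nu']_(x in D) (EFin \o h n) x)%E.
  by under [in RHS]eq_fun do rewrite suf.
transitivity (\int[nu']_(x in D)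
   (\sum_(y \in range (h n)) (y * \1_(h n @^-1` [set y]) x)%:E))%E; last first.
  by apply: eq_integral => t tE; rewrite /= fimfunE -fsumEFin.
have indich m r : measurable_fun D (fun x => (r * \1_(h m @^-1` [set r]) x)%:E).
  by apply: (measurable_comp measurableT) => //; exact: measurable_funM.
rewrite ge0_integral_fsum//; last by move=> m y Ey; exact: nnfun_muleindic_ge0.
transitivity (\int[mu]_(x in D) (\sum_(y \in range (h n))
    (y * \1_(h n @^-1` [set y]) x)%:E * (g x)%:E))%E.
  under [RHS]eq_integral => x xE.
    rewrite -ge0_mule_fsuml => [|y]; last exact: nnfun_muleindic_ge0.
    rewrite fsumEFin // -(fimfunE _ x); over.
  by [].
rewrite ge0_integral_fsum//; last 2 first.
  - by move=> y; apply: emeasurable_funM.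
  - by move=> m y Dy; apply: mule_ge0; [exact: nnfun_muleindic_ge0|rewrite lee_fin g0].
apply: eq_fsbigr => r rhn.
under [RHS]eq_integral do rewrite EFinM.
rewrite integralZl_indic_nnsfun => //.
under eq_integral do rewrite EFinM -muleA.
have mhr : measurable (h n @^-1` [set r]) by [].
rewrite integral_indic// nuE; [|exact: measurableI|by move=> x []].
have r0 : (0 <= r)%R by move: rhn; rewrite inE => -[x _ <-].
rewrite ge0_integralZl//.
- under eq_integral do rewrite muleC.
  rewrite (eq_integral ((EFin \o g) \_ (h n @^-1` [set r]))); last first.
    by move=> x xE; rewrite epatch_indic.
  by rewrite -integral_mkcondr// setIC.
- by apply: emeasurable_funM => //; exact/measurable_EFinP.
- by move=> x Dx; rewrite mule_ge0 ?lee_fin ?g0.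
Qed.

End density.

Lemma ge0_nu_integral (R : realType) n (D : set 'rV[R]_n) (f : 'rV[R]_n -> \bar R) :
  measurable D -> D `<=` unit_ball R n ->
  (forall x, D x -> (0 <= f x)%E) -> measurable_fun D f ->
  (\int[nu R n]_(x in D) f x =
   \int[lebesgue_rV R n]_(x in D) (f x * (hyp_density x)%:E))%E.
Proof.
move=> mD DB f0 mf.
apply: (@ge0_integral_density _ _ R (lebesgue_rV R n) (nu R n)) => //.
- apply: measurable_funS measurable_hyp_density => //; exact: measurable_unit_ball.
- by move=> x /DB; exact: hyp_density_ge0.
- move=> A mA AD.
  suff AB : A `&` unit_ball R n = A by rewrite -[in RHS]AB.
  by apply: setIidl; exact: subset_trans AD DB.
Qed.
(** * Functions with explicit continuous partial derivatives *)

(** The partial derivatives are carried as explicit functions, so that the rules below compute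
    gradients and second derivatives by composition, as formulas on which [ring] and [field] can
    act. *)
Definition C1_grad (R : realType) n (U : set 'rV[R]_n) (u : 'rV[R]_n -> R)
    (du : 'I_n -> 'rV[R]_n -> R) : Prop :=
  forall x, U x -> {for x, continuous u} /\
    forall i, is_derive x (delta_mx ord0 i) u (du i x) /\ {for x, continuous (du i)}.

(** Only the derivative of [u] along [v] is available, not a differential, so the one-variable chain
    rule is applied to the restriction of [u] to a line. *)
Lemma is_derive_dir_comp (R : realType) (V : normedModType R) (g : R -> R)
    (u : V -> R) (x v : V) dg du :
  is_derive x v u du -> is_derive (u x) 1 g dg ->
  is_derive x v (fun y => g (u y)) (dg * du).
Proof.
move=> ux gu.
have lineE (w : V -> R) d :
    is_derive x v w d <-> is_derive (0 : R) 1 (fun s => w (s *: v + x)) d.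
  set wl := fun s : R => w _.
  have E : (fun h : R => h^-1 *: ((w \o shift x) (h *: v) - w x)) =
     (fun h : R => h^-1 *: ((wl \o shift 0) (h *: 1) - wl 0)).
    by apply/funext => h; rewrite /wl /= addr0 scale0r add0r [h *: 1]mulr1.
  by split=> -[h1 h2]; split;
    rewrite ?/derivable ?/derive -?E// ?E// -h2 /derive ?E.
apply/lineE; have /lineE := ux; set ul := fun s => u _ => dul.
have gul : is_derive (ul 0) 1 g dg by rewrite /ul scale0r add0r.
exact: is_derive1_comp.
Qed.

Section C1_grad_theory.
Context {R : realType} {n : nat}.
Variable U : set 'rV[R]_n.
Implicit Types (u v : 'rV[R]_n -> R) (du dv : 'I_n -> 'rV[R]_n -> R).

Lemma C1_cst c : C1_grad U (fun=> c) (fun _ _ => 0).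
Proof.
move=> x _; split=> [|i]; first exact: cst_continuous.
by split; [exact: is_derive_cst|exact: cst_continuous].
Qed.

Lemma C1_coord j : C1_grad U (fun x => x ord0 j) (fun i _ => (i == j)%:R).
Proof.
move=> x _; split=> [|i]; first exact: continuous_coord.
split; last exact: cst_continuous.
have E : (fun h : R => h^-1 *: (((fun y : 'rV[R]_n => y ord0 j) \o shift x) (h *: delta_mx ord0 i)
     - x ord0 j)) @ 0^' --> ((i == j)%:R : R).
  apply: cvg_near_cst; near=> h.
  rewrite /= !mxE eqxx/= addrK eq_sym [h^-1 *: _]mulrA mulVf ?mul1r//.
  by near: h; exact: nbhs_dnbhs_neq.
by split; [apply: cvgP E|exact: cvg_lim E].
Unshelve. all: by end_near. Qed.

Lemma C1_eq u u' du du' : (forall x, u x = u' x) ->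
  (forall i x, du i x = du' i x) -> C1_grad U u du -> C1_grad U u' du'.
Proof.
move=> e de; rewrite (_ : u = u'); last exact/funext.
rewrite (_ : du = du')//.
by apply/funext => i; apply/funext => x; exact: de.
Qed.

Lemma C1D u du v dv : C1_grad U u du -> C1_grad U v dv ->
  C1_grad U (fun x => u x + v x) (fun i x => du i x + dv i x).
Proof.
move=> cu cv x Ux; have [ux dux] := cu x Ux; have [vx dvx] := cv x Ux.
split=> [|i]; first exact: continuousD.
have [h1 h2] := dux i; have [h3 h4] := dvx i.
by split; [exact: is_deriveD|exact: continuousD].
Qed.

Lemma C1M u du v dv : C1_grad U u du -> C1_grad U v dv ->
  C1_grad U (fun x => u x * v x) (fun i x => u x * dv i x + du i x * v x).
Proof.
move=> cu cv x Ux; have [ux dux] := cu x Ux; have [vx dvx] := cv x Ux.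
split=> [|i]; first exact: continuousM.
have [h1 h2] := dux i; have [h3 h4] := dvx i.
split; last by apply: continuousD; exact: continuousM.
apply: (is_derive_eq (is_deriveM h1 h3)).
by congr (_ + _); rewrite mulrC.
Qed.

Lemma C1Z c u du : C1_grad U u du ->
  C1_grad U (fun x => c * u x) (fun i x => c * du i x).
Proof.
move=> cu; apply: C1_eq (C1M (C1_cst c) cu) => // i x.
by rewrite mul0r addr0.
Qed.

Lemma C1B u du v dv : C1_grad U u du -> C1_grad U v dv ->
  C1_grad U (fun x => u x - v x) (fun i x => du i x - dv i x).
Proof.
move=> cu cv; apply: C1_eq (C1D cu (C1Z (-1) cv)) => [x|i x];
by rewrite mulN1r.
Qed.

Lemma C1_comp (g g' : R -> R) u du : C1_grad U u du ->
  (forall x, U x -> is_derive (u x) 1 g (g' (u x)) /\ {for u x, continuous g'}) ->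
  C1_grad U (fun x => g (u x)) (fun i x => g' (u x) * du i x).
Proof.
move=> cu cg x Ux; have [ux dux] := cu x Ux; have [dg cg'] := cg x Ux.
split=> [|i].
  apply: continuous_comp ux _; apply: differentiable_continuous.
  by apply/derivable1_diffP; have [] := dg.
have [h1 h2] := dux i; split; first exact: is_derive_dir_comp.
by apply: continuousM h2; exact: continuous_comp.
Qed.

Lemma C1_sum (I : Type) (r : seq I) (u : I -> 'rV[R]_n -> R)
    (du : I -> 'I_n -> 'rV[R]_n -> R) :
  (forall k, C1_grad U (u k) (du k)) ->
  C1_grad U (fun x => \sum_(k <- r) u k x) (fun i x => \sum_(k <- r) du k i x).
Proof.
move=> cu; elim: r => [|k r ih].
  by apply: C1_eq (C1_cst 0) => [x|i x]; rewrite big_nil.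
by apply: C1_eq (C1D (cu k) ih) => [x|i x]; rewrite big_cons.
Qed.

Lemma C1_dotp : C1_grad U (fun x => dotp x x) (fun i x => 2 * x ord0 i).
Proof.
have h k := C1M (C1_coord k) (C1_coord k).
apply: C1_eq (C1_sum _ h) => [//|i x].
rewrite (bigD1 i)//= eqxx big1 ?addr0 => [|k ki]; first by rewrite mulr1 mul1r; ring.
by rewrite eq_sym (negbTE ki) mulr0 mul0r addr0.
Qed.

Lemma C1_dotpB z : C1_grad U (fun x => dotp (x - z) (x - z))
  (fun i x => 2 * (x ord0 i - z ord0 i)).
Proof.
have h k : C1_grad U (fun x => (x - z) ord0 k) (fun i _ => (i == k)%:R).
  by apply: C1_eq (C1B (C1_coord k) (C1_cst (z ord0 k))) => [x|i x];
    rewrite ?mxE ?subr0.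
have h' k := C1M (h k) (h k).
apply: C1_eq (C1_sum _ h') => [//|i x].
rewrite (bigD1 i)//= eqxx big1 ?addr0 => [|k ki]; first by rewrite !mxE mulr1 mul1r; ring.
by rewrite eq_sym (negbTE ki) mulr0 mul0r addr0.
Qed.

Lemma C1_ext u u' du du' : open U -> (forall x, U x -> u x = u' x) ->
  (forall i x, U x -> du i x = du' i x) -> C1_grad U u du -> C1_grad U u' du'.
Proof.
move=> oU uu' dudu' cu x Ux; have [ux dux] := cu x Ux.
have nU : nbhs x U by exact: open_nbhs_nbhs.
have near_eq w w' : (forall x, U x -> w x = w' x) ->
    {for x, continuous w} -> {for x, continuous w'}.
  move=> ww' wx; rewrite /prop_for /continuous_at -(ww' x Ux).
  apply: cvg_trans wx; apply: near_eq_cvg; first exact: (nbhs_filter (x : 'rV[R]_n)).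
  by apply: filterS nU => y Uy; rewrite ww'.
split=> [|i]; first exact: near_eq uu' ux.
have [h1 h2] := dux i; split; last exact: near_eq (dudu' i) h2.
rewrite -dudu'//; apply: near_eq_is_derive h1.
by apply: filterS nU => y Uy; exact: uu'.
Qed.

Lemma C1_partial u du x i : C1_grad U u du -> U x -> partial i u x = du i x.
Proof. by move=> cu Ux; have [_ /(_ i)[[_ ?] _]] := cu x Ux. Qed.

(** Bridge from explicit formulas to the iterated operator [partial]. The two are known to agree
    only on [U], hence the repeated use of [C1_ext], for which [U] has to be open. *)
Lemma C1_C2_on u du ddu : open U -> C1_grad U u du ->
  (forall i, C1_grad U (du i) (ddu i)) ->
  C2_on U u /\ forall i j x, U x -> partial i (partial j u) x = ddu j i x.
Proof.
move=> oU cu cdu.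
have cu' : C1_grad U u (fun i => partial i u).
  by apply: (C1_ext oU _ _ cu) => // i x Ux; rewrite (C1_partial _ cu).
have cdu' i : C1_grad U (partial i u) (fun j => partial j (partial i u)).
  have c1 : C1_grad U (partial i u) (ddu i).
    by apply: (C1_ext oU _ _ (cdu i)) => // x Ux; rewrite (C1_partial _ cu).
  by apply: (C1_ext oU _ _ c1) => // j x Ux; rewrite (C1_partial _ c1).
split=> [x Ux|i j x Ux].
  have [h1 h2] := cu' x Ux; split=> // [i|i j].
    by have [[? _] ?] := h2 i.
  by have [_ /(_ i)[[? _] ?]] := cdu' j x Ux.
have c1 : C1_grad U (partial j u) (ddu j).
  by apply: (C1_ext oU _ _ (cdu j)) => // y Uy; rewrite (C1_partial _ cu).
exact: C1_partial c1 Ux.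
Qed.

End C1_grad_theory.

Lemma antiderivative (R : realType) (b : R -> R) (a : R) :
  (forall s, a <= s -> {for s, continuous b}) ->
  exists B : R -> R, forall s, a < s -> is_derive s 1 B (b s).
Proof.
move=> cb; exists (fun s => \int[lebesgue_measure]_(t in [set` `[a, s]]) (b t))%R.
(* Integrating up to [s + 1] puts [s] in the interior of the interval, so that the derivative there
   is two-sided. *)
move=> s as_; have ss1 : s < s + 1 by rewrite ltrDl.
have ib : lebesgue_measure.-integrable `[a, s + 1] (EFin \o b).
  apply: continuous_compact_integrable; first exact: segment_compact.
  apply: continuous_in_subspaceT => t; rewrite inE/= in_itv/= => /andP[at_ _].
  exact: cb.
have [dB B'] := continuous_FTC1_closed ss1 ib as_ (cb s (ltW as_)).
by split; [exact: dB|rewrite -derive1E B'].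
Qed.

Lemma is_derive_continuous (R : realType) (f : R -> R) (x d : R) :
  is_derive x 1 f d -> {for x, continuous f}.
Proof.
by move=> [df _]; apply: differentiable_continuous; exact/derivable1_diffP.
Qed.

Lemma is_derive0_const (R : realType) (B : R -> R) (a s : R) : a <= s ->
  (forall t, a <= t -> is_derive t 1 B 0) -> B s = B a.
Proof.
move=> as_ dB.
have cB : {within `[a, s], continuous B}.
  apply: continuous_in_subspaceT => t; rewrite inE/= in_itv/= => /andP[at_ _].
  exact: is_derive_continuous (dB _ at_).
have dB' x : x \in `]a, s[ -> is_derive x 1 B 0.
  by rewrite in_itv/= => /andP[/ltW/dB].
have [c _] := MVT_segment as_ dB' cB.
by rewrite mul0r => /eqP; rewrite subr_eq0 => /eqP.
Qed.

Lemma is_derive_powR (R : realType) (a x : R) : 0 < x ->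
  is_derive x 1 (fun t => t `^ a) (a * (x `^ a / x)).
Proof.
move=> x0; apply: is_derive_eq; first exact: is_derive1_powR.
by congr (_ * _); rewrite powRB ?powRr1 ?ltW// (gt_eqF x0) implybT.
Qed.
(** * The mean value property with radial weights *)

Lemma bernoulli (R : realType) (u : R) n : 0 <= u <= 1 -> 1 - n%:R * u <= (1 - u) ^+ n.
Proof.
move=> /andP[u0 u1]; elim: n => [|n ih]; first by rewrite mul0r subr0.
rewrite exprSr; apply: (@le_trans _ _ ((1 - n%:R * u) * (1 - u))).
  have : 0 <= n%:R * u * u by rewrite !mulr_ge0.
  by rewrite -natr1; lra.
by rewrite ler_wpM2r// subr_ge0.
Qed.

(** [w] is [(s / (s + e)) ^ (n / 2)]. The half-integer power disappears in [1 - w <= 1 - w ^+ 2], to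
    which Bernoulli's inequality applies because [w ^+ 2 = (1 - e / (s + e)) ^+ n]. *)
Lemma radial_ratio (R : realType) n (s e : R) : (2 <= n)%N -> 0 <= s -> 0 < e ->
  let w := s * Num.sqrt s ^+ (n - 2) * (s + e) `^ (- (n%:R / 2)) in
  0 <= w <= 1 /\ 1 - w <= n%:R * e / (s + e).
Proof.
move=> n2 s0 e0 w; have se0 : 0 < s + e by lra.
have w0 : 0 <= w.
  by rewrite /w !mulr_ge0// ?exprn_ge0 ?sqrtr_ge0// powR_ge0.
have w2 : w ^+ 2 = (1 - e / (s + e)) ^+ n.
  have -> : 1 - e / (s + e) = s / (s + e) by field; rewrite gt_eqF.
  rewrite /w; have -> : s * Num.sqrt s ^+ (n - 2) = Num.sqrt s ^+ n.
    by rewrite -{1}(sqr_sqrtr s0) -exprD subnKC.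
  rewrite exprMn -exprM mulnC exprM sqr_sqrtr// expr_div_n; congr (_ * _).
  rewrite expr2 -powRD; last by rewrite (gt_eqF se0) implybT.
  rewrite (_ : - (n%:R / 2) + - (n%:R / 2) = - n%:R :> R); last by field.
  by rewrite powRN powR_mulrn// ltW.
have u01 : 0 <= e / (s + e) <= 1.
  by rewrite divr_ge0 ?(ltW e0) ?(ltW se0)//= ler_pdivrMr// mul1r; lra.
have w1 : w <= 1.
  rewrite -(@ler_pXn2r _ 2) ?nnegrE// w2 expr1n exprn_ile1 ?subr_ge0//.
    by case/andP: u01.
  by case/andP: u01 => ? _; lra.
split; first by rewrite w0.
apply: (@le_trans _ _ (1 - w ^+ 2)); first by rewrite lerD2l lerN2 expr2 ler_piMl.
by have := bernoulli n u01; rewrite -w2 mulrA; lra.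
Qed.

Lemma is_derive_ge0_le (R : realType) (B b : R -> R) (s t : R) : s <= t ->
  (forall u, s <= u <= t -> is_derive u 1 B (b u)) ->
  (forall u, s <= u <= t -> 0 <= b u) -> B s <= B t.
Proof.
move=> st dB b0.
have cB : {within `[s, t], continuous B}.
  apply: continuous_in_subspaceT => u; rewrite inE/= in_itv/= => ust.
  exact: is_derive_continuous (dB _ ust).
have dB' x : x \in `]s, t[ -> is_derive x 1 B (b x).
  by rewrite in_itv/= => /andP[/ltW sx /ltW xt]; apply: dB; rewrite sx.
have [c] := MVT_segment st dB' cB.
by rewrite in_itv/= => /b0 bc e; rewrite -subr_ge0 e mulr_ge0// subr_ge0.
Qed.

(* The choice [k(s) = (s + e)^(- n / 2) chi(s)] with
   [chi' = - s^(n / 2 - 1) beta] turns [n k + 2 s k'] into the difference of a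
   kernel concentrating at [0] and a quantity tending to [2 beta]. *)
Lemma approx_kernel (R : realType) n (beta : R -> R) (c C : R) :
  (2 <= n)%N -> 0 < c -> continuous beta -> (forall s, 0 <= beta s <= C) ->
  (forall s, c <= s -> beta s = 0) ->
  forall rho : R, 0 < rho -> exists2 K : R, 0 <= K & forall e : R, 0 < e <= 1 ->
  exists k k' : R -> R,
  [/\ forall s : R, - e < s -> is_derive s 1 k (k' s) /\ {for s, continuous k'},
      forall s, c <= s -> k s = 0, forall s, c <= s -> k' s = 0,
      forall s, 0 <= s -> 0 <= n%:R * k s + 2 * s * k' s + 2 * beta s &
      forall s, rho <= s -> n%:R * k s + 2 * s * k' s + 2 * beta s <= K * e].
Proof.
move=> n2 c0 cb b0 bc rho rho0.
(* This is [s^(n / 2 - 1) beta]; the half-integer power is written through [Num.sqrt], which is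
   continuous on the whole line. *)
pose b (s : R) : R := Num.sqrt s ^+ (n - 2) * beta s.
have bge0 (s : R) : 0 <= b s.
  by rewrite mulr_ge0 ?exprn_ge0 ?sqrtr_ge0//; case/andP: (b0 s).
have cbb (s : R) : {for s, continuous b}.
  apply: continuousM; last exact: cb.
  apply: (@continuous_comp _ _ _ (@Num.sqrt R) (fun s => s ^+ (n - 2))).
    exact: sqrt_continuous.
  exact: exprn_continuous.
(* Starting at [- 1] makes [B] differentiable on [(- e, +oo)] for every [e <= 1], in particular at
   [0], the value of [dotp x x] at the origin. *)
have [B dB] := @antiderivative R b (- 1) (fun s _ => cbb s).
pose chi s := B c - B s.
have dchi (s : R) : - 1 < s -> is_derive s 1 chi (- b s).
  move=> /dB dBs; apply: (is_derive_eq (is_deriveB (is_derive_cst _ _ _) dBs)).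
  by rewrite sub0r.
have chi0 (s : R) : c <= s -> chi s = 0.
  move=> cs; apply/eqP; rewrite subr_eq0 eq_sym; apply/eqP.
  apply: is_derive0_const cs _ => t ct; have := dB t.
  by rewrite /b bc// mulr0; apply; lra.
have Bmono (s t : R) : - 1 < s -> s <= t -> B s <= B t.
  by move=> s1 st; apply: (@is_derive_ge0_le R B b) => // u /andP[su _]; apply: dB; lra.
have chige0 (s : R) : 0 <= s -> 0 <= chi s.
  move=> s0; have [cs|sc] := leP c s; first by rewrite chi0.
  by rewrite subr_ge0 Bmono ?ltW//; lra.
have chile (s : R) : 0 <= s -> chi s <= chi 0.
  by move=> s0; rewrite lerD2l lerN2 Bmono//; lra.
pose q : R := - (n%:R / 2).
pose K := n%:R * chi 0 * (rho `^ (n%:R / 2) * rho)^-1 + 2 * C * (n%:R / rho).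
have C0 : 0 <= C by case/andP: (b0 0); exact: le_trans.
have prho : 0 < rho `^ (n%:R / 2) * rho by rewrite mulr_gt0 ?powR_gt0.
exists K.
  by rewrite addr_ge0// !mulr_ge0 ?chige0// ?invr_ge0 ltW.
move=> e /andP[e0 e1].
pose p (s : R) : R := (s + e) `^ q.
have dp (s : R) : - e < s -> is_derive s 1 p (q * (p s / (s + e))).
  move=> es; have se0 : 0 < s + e by lra.
  have ds : is_derive s 1 (fun t : R => t + e) 1.
    by apply: (is_derive_eq (is_deriveD (is_derive_id _ _) (is_derive_cst _ _ _)));
      rewrite addr0.
  by apply: (is_derive_eq (is_derive_dir_comp ds (is_derive_powR q se0)));
    rewrite mulr1.
exists (fun s => p s * chi s), (fun s => p s * (- b s) + q * (p s / (s + e)) * chi s).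
(* The shifted power satisfies [n p + 2 s p' = n e p / (s + e)]. Both terms on the right are
   nonnegative, and of order [e] away from [0]. *)
have algE (s : R) : 0 <= s ->
   n%:R * (p s * chi s) + 2 * s * (p s * (- b s) + q * (p s / (s + e)) * chi s)
     + 2 * beta s =
   n%:R * chi s * (p s / (s + e)) * e +
     2 * beta s * (1 - s * Num.sqrt s ^+ (n - 2) * p s).
  move=> s0; rewrite /b /q; have se0 : s + e != 0 by rewrite gt_eqF//; lra.
  by field.
split=> [s es|s cs|s cs|s s0|s rs].
- have se0 : 0 < s + e by lra.
  have es1 : - 1 < s by lra.
  have dps := dp s es; have dcs := dchi s es1; split.
    apply: (is_derive_eq (is_deriveM dps dcs)).
    by congr (_ + _); rewrite [_ *: _]mulrC.
  have cps := is_derive_continuous dps; have ccs := is_derive_continuous dcs.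
  apply: continuousD.
    by apply: continuousM cps _; apply: continuousN; exact: cbb.
  apply: continuousM ccs; apply: continuousM; first exact: cst_continuous.
  apply: continuousM cps _; apply: continuousV; first by rewrite gt_eqF.
  by apply: continuousD; [exact: cvg_id|exact: cst_continuous].
- by rewrite chi0 ?mulr0.
- by rewrite chi0// /b bc// !mulr0 oppr0 mulr0 addr0.
- rewrite algE//; have [/andP[_ w1] _] := radial_ratio n2 s0 e0.
  have se0 : 0 <= s + e by lra.
  apply: addr_ge0.
    by rewrite !mulr_ge0 ?chige0// ?invr_ge0 ?powR_ge0// ltW.
  by rewrite !mulr_ge0// ?subr_ge0//; case/andP: (b0 s).
have s0 : 0 <= s by lra.
have se0 : 0 < s + e by lra.
have rse : rho <= s + e by lra.
rewrite algE// /K [leRHS]mulrDl; apply: lerD.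
  rewrite ler_wpM2r ?(ltW e0)//; apply: ler_pM.
  - by rewrite mulr_ge0 ?chige0.
  - by rewrite divr_ge0 ?powR_ge0// ltW.
  - by rewrite ler_wpM2l// chile.
  rewrite /p /q powRN -invfM lef_pV2 ?posrE ?mulr_gt0 ?powR_gt0//.
  apply: ler_pM => //; [exact: powR_ge0|exact: ltW|].
  by apply: ge0_ler_powR; rewrite ?nnegrE ?divr_ge0// ltW.
have [/andP[_ w1] w2] := radial_ratio n2 s0 e0.
rewrite -[leRHS]mulrA; apply: ler_pM; rewrite ?subr_ge0//.
- by rewrite mulr_ge0//; case/andP: (b0 s).
- by rewrite ler_wpM2l//; case/andP: (b0 s).
apply: le_trans w2 _; rewrite -mulrA (mulrC e) mulrA ler_wpM2r ?(ltW e0)//.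
by rewrite ler_wpM2l// lef_pV2.
Qed.

(** * The divergence theorem for radially weighted fields *)

Section divergence.
Context {R : realType} {n : nat}.
Variables (r r1 : R).
Hypotheses (r10 : 0 < r1) (r1r : r1 < r).
Let U : set 'rV[R]_n := [set x | enorm x < r].

(** The field is known to be [C^1] only for [|x| < r]. Vanishing from [r1 < r] on, it glues with
    zero to a field on the whole space, and each [dF j j] integrates to [0] separately. [D] is the
    divergence in simplified form. *)
Lemma integral_divergence0 (F : 'I_n -> 'rV[R]_n -> R)
    (dF : 'I_n -> 'I_n -> 'rV[R]_n -> R) (D : 'rV[R]_n -> R) :
  (forall j, C1_grad U (F j) (dF j)) ->
  (forall j x, r1 <= enorm x -> F j x = 0) ->
  (forall j x, r1 <= enorm x -> dF j j x = 0) ->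
  (forall x, \sum_(j < n) dF j j x = D x) ->
  (lebesgue_rV R n).-integrable setT (fun x => (D x)%:E) /\
  (\int[lebesgue_rV R n]_x (D x)%:E)%E = 0%E.
Proof.
move=> cF F0 dF0 dFD; have -> : D = fun x => \sum_(j < n) dF j j x by apply/funext.
have out (x : 'rV[R]_n) : ~ ball (0 : 'rV[R]_n) r1 x -> r1 <= enorm x.
  rewrite -ball_normE /= sub0r normrN => /negP; rewrite -leNgt.
  by move/le_trans; apply; exact: norm_le_enorm.
have near0 (w : 'rV[R]_n -> R) (x : 'rV[R]_n) : (forall x, r1 <= enorm x -> w x = 0) ->
    ~ U x -> \near x, 0 = w x.
  move=> w0 /negP; rewrite -leNgt => rx.
  have : nbhs x [set y | r1 < enorm y].
    apply: open_nbhs_nbhs; split; first exact: open_enorm_gt.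
    exact: lt_le_trans rx.
  by apply: filterS => y /= /ltW /w0.
have dFj j (x : 'rV[R]_n) : is_derive x (delta_mx ord0 j) (F j) (dF j j x).
  have [Ux|nUx] := pselect (U x); first by have [_ /(_ j)[]] := cF j x Ux.
  rewrite dF0; last by move/negP : nUx; rewrite -leNgt; apply: le_trans; exact: ltW.
  apply: (@near_eq_is_derive _ _ _ (cst 0) (F j)); first exact: near0 (F0 j) nUx.
have cdF j : continuous (dF j j).
  move=> x; have [Ux|nUx] := pselect (U x); first by have [_ /(_ j)[]] := cF j x Ux.
  have h := near0 _ _ (dF0 j) nUx.
  rewrite /continuous_at -(nbhs_singleton h).
  have FF := nbhs_filter (x : 'rV[R]_n).
  apply: (@cvg_trans _ ((fun=> 0 : R) @ nbhs (x : 'rV[R]_n))).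
    exact: near_eq_cvg h.
  exact: (@cst_continuous _ _ (0 : R) x).
have idF j : (lebesgue_rV R n).-integrable setT (fun x => (dF j j x)%:E).
  apply: (@continuous_supp_integrable _ _ (dF j j) r1) => // x /out.
  exact: dF0.
split.
  under eq_fun do rewrite -sumEFin.
  exact: integrable_sum.
under eq_integral do rewrite -sumEFin.
rewrite integral_sum// big1// => j _.
apply: (@integral_partial0 _ _ j (F j) (dF j j) r1) => //.
  by move=> x /out; exact: F0.
by move=> x /out; exact: dF0.
Qed.

(** The equation is that of the invariant Laplacian without its outer factor [1 - |x|^2]. *)
Definition hyp_harmonic_grad (f : 'rV[R]_n -> R) (df : 'I_n -> 'rV[R]_n -> R)
    (ddf : 'I_n -> 'I_n -> 'rV[R]_n -> R) : Prop :=
  [/\ C1_grad U f df, forall j, C1_grad U (df j) (ddf j) &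
   forall x, U x -> (1 - dotp x x) * (\sum_(i < n) ddf i i x) +
     2 * (n%:R - 2) * (\sum_(i < n) x ord0 i * df i x) = 0].

Lemma continuous_dpowR (a t : R) : 0 < t ->
  {for t, continuous (fun t : R => a * (t `^ a / t))}.
Proof.
move=> t0; apply: continuousM; first exact: cst_continuous.
apply: continuousM; first exact: is_derive_continuous (is_derive_powR a t0).
by apply: continuousV => //; rewrite gt_eqF.
Qed.

(* Divergence theorem for the field [k f x - h (1 - |x|^2)^(2 - n) grad f / 2],
   where [h' = k (1 - s)^(n - 2)] makes the terms in [x . grad f] cancel. *)
Lemma radial_identity (f : 'rV[R]_n -> R) df ddf (k k' : R -> R) (a : R) :
  (2 <= n)%N -> r <= 1 -> a < 0 ->
  hyp_harmonic_grad f df ddf ->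
  (forall s, a < s -> is_derive s 1 k (k' s) /\ {for s, continuous k'}) ->
  (forall s, r1 ^+ 2 <= s -> k s = 0) ->
  (forall s, r1 ^+ 2 <= s -> k' s = 0) ->
  (lebesgue_rV R n).-integrable setT
    (fun x => (f x * (n%:R * k (dotp x x) + 2 * dotp x x * k' (dotp x x)))%:E) /\
  (\int[lebesgue_rV R n]_x
    (f x * (n%:R * k (dotp x x) + 2 * dotp x x * k' (dotp x x)))%:E)%E = 0%E.
Proof.
move=> n2 r_le1 a0 [cf cdf harm] dk k0 k'0.
pose h' s := k s * (1 - s) ^+ (n - 2).
(* [k] is controlled only beyond [a < 0]. The antiderivative starts at [a / 2], so that [h'] is
   continuous up to the endpoint and every value of [dotp x x] lies beyond it. *)
have [h [dh h0]] : exists h : R -> R, (forall s, a / 2 < s -> is_derive s 1 h (h' s)) /\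
    (forall s, r1 ^+ 2 <= s -> h s = 0).
  have ch' s : a / 2 <= s -> {for s, continuous h'}.
    move=> as_; apply: continuousM.
      by apply: (is_derive_continuous (dk s _).1); lra.
    apply: (@continuous_comp _ _ _ (fun s : R => 1 - s) (fun s => s ^+ (n - 2))).
      by apply: continuousB; [exact: cst_continuous|exact: cvg_id].
    exact: exprn_continuous.
  have [B dB] := antiderivative ch'.
  exists (fun s => B s - B (r1 ^+ 2)); split=> [s /dB dBs|s rs].
    by apply: (is_derive_eq (is_deriveB dBs (is_derive_cst _ _ _))); rewrite subr0.
  apply/eqP; rewrite subr_eq0; apply/eqP; apply: is_derive0_const rs _ => t rt.
  have : a / 2 < t by apply: lt_le_trans rt; have := sqr_ge0 r1; lra.
  by move/dB; rewrite /h' k0// mul0r.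
have S0 (x : 'rV[R]_n) : a < dotp x x by apply: lt_le_trans (dotp_ge0 x).
have S0' (x : 'rV[R]_n) : a / 2 < dotp x x by apply: lt_le_trans (dotp_ge0 x); lra.
have S1 x : U x -> 0 < 1 - dotp x x.
  rewrite /U /= subr_gt0 -sqr_enorm => xr.
  by rewrite expr_lt1// ?enorm_ge0// (lt_le_trans xr).
have ch' s : a / 2 < s -> {for s, continuous h'}.
  move=> as_; apply: continuousM.
    by apply: (is_derive_continuous (dk s _).1); lra.
  apply: (@continuous_comp _ _ _ (fun s : R => 1 - s) (fun s => s ^+ (n - 2))).
    by apply: continuousB; [exact: cst_continuous|exact: cvg_id].
  exact: exprn_continuous.
have cS : C1_grad U (fun x => dotp x x) _ := C1_dotp (U := U).
have ck := C1_comp (g := k) (g' := k') cS (fun x _ => dk _ (S0 x)).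
have ch := C1_comp (g := h) (g' := h') cS
  (fun x _ => conj (dh _ (S0' x)) (ch' _ (S0' x))).
pose m : R := - (n - 2)%:R.
have cw := C1_comp (g := fun t => t `^ m) (g' := fun t => m * (t `^ m / t))
  (C1B (C1_cst 1) cS)
  (fun x Ux => conj (@is_derive_powR R m _ (S1 x Ux)) (@continuous_dpowR m _ (S1 x Ux))).
have cF j := C1B (C1M cf (C1M ck (C1_coord j)))
  (C1Z 2^-1 (C1M ch (C1M cw (cdf j)))).
have big x : r1 <= enorm x -> r1 ^+ 2 <= dotp x x.
  by move=> rx; rewrite -sqr_enorm ler_pXn2r// nnegrE ?enorm_ge0// ltW.
have h'0 x : r1 <= enorm x -> h' (dotp x x) = 0.
  by move=> /big rx; rewrite /h' k0// mul0r.
apply: (integral_divergence0 cF) => [j x rx|j x rx|x].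
- by rewrite k0 ?h0 ?big// !(mul0r, mulr0) subrr.
- by rewrite k0 ?k'0 ?h0 ?h'0 ?big// !(mul0r, mulr0, addr0) subrr.
have [Ux|nUx] := pselect (U x); last first.
  have rx : r1 <= enorm x.
    by apply: le_trans (ltW r1r) _; rewrite leNgt; apply/negP.
  rewrite k0 ?k'0 ?big// !mulr0 addr0 mulr0 big1// => j _.
  by rewrite h0 ?h'0 ?big// !(mul0r, mulr0, addr0) subrr.
have hw : h' (dotp x x) * (1 - dotp x x) `^ m = k (dotp x x).
  rewrite /h' -mulrA -powR_mulrn ?ltW ?S1// /m -powRD ?subrr ?powRr0 ?mulr1//.
  by rewrite ?subrr eqxx/= (gt_eqF (S1 x Ux)).
have {}harm := harm x Ux.
have mE : m = 2 - n%:R by rewrite /m natrB// opprB.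
set w := _ `^ m in hw *; pose c := w / (1 - dotp x x).
have wE : w = c * (1 - dotp x x) by rewrite divfK// gt_eqF ?S1.
rewrite -/c -/w; set P := \sum_(i < n) x ord0 i * df i x in harm.
set L := \sum_(i < n) ddf i i x in harm; set S := dotp x x in hw wE harm *.
(* In the coefficient of [x . grad f] the first two terms cancel because [h' w = k]; the third,
   [h m c], cancels against the Laplacian term by harmonicity, as [w = c (1 - S)] and
   [m = 2 - n]. *)
transitivity (\sum_(j < n) (f x * k S + 2 * f x * k' S * (x ord0 j * x ord0 j)
    + (k S - h' S * w + h S * m * c) * (x ord0 j * df j x)
    - 2^-1 * h S * w * ddf j j x)).
  by apply: eq_bigr => j _; rewrite eqxx mulr1; field.
rewrite sumrB !big_split/= -!mulr_sumr -/P -/L -/(dotp x x) -/S.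
rewrite sumr_const card_ord -[_ *+ n]mulr_natl hw subrr add0r.
have -> : h S * m * c * P = 2^-1 * h S * w * L.
  by rewrite wE mE; apply/eqP; rewrite -subr_eq0; apply/eqP; transitivity
    (- 2^-1 * h S * c * ((1 - S) * L + 2 * (n%:R - 2) * P)); [field|rewrite harm mulr0].
by rewrite addrK; ring.
Qed.

End divergence.
Lemma enorm_ball_integrable (R : realType) n (r1 : R) (G : 'rV[R]_n -> R) C :
  measurable_fun [set x : 'rV[R]_n | enorm x < r1] G ->
  (forall x, enorm x < r1 -> `|G x| <= C) -> (forall x, r1 <= enorm x -> G x = 0) ->
  (lebesgue_rV R n).-integrable setT (EFin \o G).
Proof.
move=> mG GC G0; pose A := [set x : 'rV[R]_n | enorm x < r1].
have mA : measurable A by apply: open_measurable_rV; exact: open_enorm_lt.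
have [r10|r10] := ltP 0 r1; last first.
  rewrite (_ : EFin \o G = cst 0%E); first exact: integrable0.
  by apply/funext => x /=; rewrite G0// (le_trans r10)// enorm_ge0.
apply: (@bounded_supp_integrable _ _ R _ A G C) => //.
  have := lebesgue_rV_ball (0 : 'rV[R]_n) r10 => e.
  apply: (@le_lt_trans _ _ ((2 * r1) ^+ n)%:E); last exact: ltry.
  rewrite -e; apply: le_measure; rewrite ?inE//; first exact: measurable_ball_rV.
  move=> x /=; rewrite -ball_normE/= sub0r normrN; apply: le_lt_trans.
  exact: norm_le_enorm.
by move=> x /negP; rewrite -leNgt; exact: G0.
Qed.

Lemma enorm_compact (R : realType) n (r1 : R) :
  compact [set x : 'rV[R]_n | enorm x <= r1].
Proof.
apply: bounded_closed_compact.
  exists r1; split; first exact: num_real.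
  by move=> D rD x /= xr; apply: le_trans (ltW rD); apply: le_trans xr; exact: norm_le_enorm.
apply: (@closed_comp _ _ (@enorm R n) [set t | t <= r1]); last exact: closed_le.
by move=> x _; exact: continuous_enorm.
Qed.

Lemma small_multiple_eq0 (R : realType) (A M : R) : 0 <= M ->
  (forall tau, 0 < tau -> `|A| <= tau * M) -> A = 0.
Proof.
move=> M0 H; apply/eqP; rewrite -normr_le0; apply/ler_addgt0Pr => e e0.
have M1 : 0 < M + 1 by lra.
rewrite add0r; apply: le_trans (H (e / (M + 1)) _) _; first exact: divr_gt0.
by rewrite mulrAC ler_pdivrMr// ler_wpM2l ?ltW//; lra.
Qed.

(** Since [n k + 2 s k' = Q - 2 beta], the radial identity for [g = f - f 0] says that twice the
    integral of [beta g] is the integral of [g Q]. Applied to the constant [1], it says that [Q] has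
    twice the mass of [beta]. As [Q >= 0] concentrates at the origin, where [g] is small, the
    integral of [g Q] is arbitrarily small. *)
Lemma mean_value_radial (R : realType) n (f : 'rV[R]_n -> R) df ddf (r r1 : R)
    (beta : R -> R) C :
  (2 <= n)%N -> 0 < r1 -> r1 < r -> r <= 1 -> hyp_harmonic_grad r f df ddf ->
  continuous beta -> (forall s, 0 <= beta s <= C) ->
  (forall s, r1 ^+ 2 <= s -> beta s = 0) ->
  (lebesgue_rV R n).-integrable setT
    (fun x => (beta (dotp x x) * (f x - f 0))%:E) /\
  (\int[lebesgue_rV R n]_x (beta (dotp x x) * (f x - f 0))%:E)%E = 0%E.
Proof.
move=> n2 r10 r1r r_le1 [cf cdf harm] cb b0 bc.
set mu := lebesgue_rV R n.
pose U : set 'rV[R]_n := [set x | enorm x < r].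
pose g x := f x - f 0.
have hg : hyp_harmonic_grad r g df ddf.
  split=> //; apply: C1_eq (C1B cf (C1_cst (f 0))) => // i x.
  by rewrite subr0.
have h1 : hyp_harmonic_grad (n := n) r (fun=> 1) (fun _ _ => 0) (fun _ _ _ => 0).
  split; [exact: C1_cst|move=> j; exact: C1_cst|move=> x _].
  by rewrite !big1 ?mulr0 ?addr0// => i _; rewrite mulr0.
have cg x : U x -> {for x, continuous g} by move=> Ux; have [c1 c2 c3] := hg; have [] := c1 x Ux.
have U0 : U 0 by rewrite /U /= enorm0; exact: lt_trans r1r.
have [Cf gCf] : exists Cf, forall x, enorm x <= r1 -> `|g x| <= Cf.
  have [D [_ hD]] : bounded_set (g @` [set x : 'rV[R]_n | enorm x <= r1]).
    apply: compact_bounded; apply: continuous_compact; last exact: enorm_compact.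
    apply: continuous_in_subspaceT => x; rewrite inE/= => xr.
    by apply: cg; exact: le_lt_trans r1r.
  exists (`|D| + 1) => x xr; apply: hD; last by exists x.
  by rewrite (le_lt_trans (ler_norm _))// ltrDl.
have Cf0 : 0 <= Cf by apply: le_trans (gCf 0 _); rewrite ?normr_ge0// enorm0 ltW.
have big (x : 'rV[R]_n) : (r1 ^+ 2 <= dotp x x) = (r1 <= enorm x).
  by rewrite -sqr_enorm ler_pXn2r// nnegrE ?enorm_ge0// ltW.
pose A := [set x : 'rV[R]_n | enorm x < r1].
have oA : open A by exact: open_enorm_lt.
have mA : measurable A by exact: open_measurable_rV.
have cbS x : {for x, continuous (fun y : 'rV[R]_n => beta (dotp y y))}.
  apply: (@continuous_comp _ _ _ (fun y : 'rV[R]_n => dotp y y) beta).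
    exact: continuous_dotp.
  exact: cb.
have i_b : mu.-integrable setT (EFin \o (fun x => beta (dotp x x))).
  apply: (@enorm_ball_integrable _ _ r1 _ C).
  - exact: continuous_measurable_rV.
  - by move=> x _; have /andP[? ?] := b0 (dotp x x); rewrite ger0_norm.
  - by move=> x; rewrite -big; exact: bc.
have i_bg : mu.-integrable setT (EFin \o (fun x => beta (dotp x x) * g x)).
  apply: (@enorm_ball_integrable _ _ r1 _ (C * Cf)).
  - apply: continuous_measurable_rV => // x Ax; apply: continuousM; first exact: cbS.
    by apply: cg; exact: lt_trans r1r.
  - move=> x /ltW/gCf xr; have /andP[? ?] := b0 (dotp x x).
    by rewrite normrM ger0_norm// ler_pM.
  - by move=> x; rewrite -big => /bc ->; rewrite mul0r.
have i_A : mu.-integrable setT (EFin \o (\1_A : 'rV[R]_n -> R)).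
  apply: (@enorm_ball_integrable _ _ r1 _ 1).
  - exact: measurable_indic.
  - by move=> x xA; rewrite indicE mem_set// normr1.
  - by move=> x xA; rewrite indicE memNset//= => /lt_geF; rewrite xA.
pose I (h : 'rV[R]_n -> R) := (\int[mu]_(x in setT) h x)%R.
pose J := I (fun x => beta (dotp x x) * g x).
suff J0 : J = 0.
  split; first exact: i_bg.
  have := integrable_fin_num measurableT i_bg.
  by move/fineK <-; rewrite [X in X%:E](_ : _ = J)// J0.
have B0 : 0 <= I (fun x => beta (dotp x x)).
  by apply: Rintegral_ge0 => x _; case/andP: (b0 (dotp x x)).
have A0 : 0 <= I (\1_A) by apply: Rintegral_ge0 => x _; rewrite indicE.
apply/eqP; rewrite -(mulrI_eq0 _ (lregP (lt0r_neq0 (ltr0Sn R 1)))); apply/eqP.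
apply: (@small_multiple_eq0 _ _ (2 * I (fun x => beta (dotp x x)) + I (\1_A))).
  by rewrite addr_ge0// mulr_ge0.
move=> tau tau0.
have [delta delta0 gdelta] : exists2 delta, 0 < delta & forall x, enorm x < delta -> `|g x| <= tau.
  have /(@cvgrPdist_le _ _ _ (nbhs (0 : 'rV[R]_n)) (nbhs_filter _)) := cg 0 U0.
  move=> /(_ tau tau0).
  rewrite /g subrr.
  move=> /nbhs_ballP[d /= d0 H]; exists d => // x xd.
  rewrite -normrN -sub0r; apply: H; rewrite -ball_normE /= sub0r normrN.
  by apply: le_lt_trans xd; exact: norm_le_enorm.
have rho0 : 0 < delta ^+ 2 by exact: exprn_gt0.
have [K K0 HK] := approx_kernel n2 (exprn_gt0 2 r10) cb b0 bc rho0.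
have CK1 : 0 < Cf * K + 1 by rewrite ltr_wpDl// mulr_ge0.
(* [delta] and then [K] are fixed before [e], which can therefore bring the bound [Cf * (K * e)]
   valid away from the origin down to [tau]; the [+ 1] guards against [Cf * K = 0]. *)
pose e := Num.min 1 (tau / (Cf * K + 1)).
have e01 : 0 < e <= 1 by rewrite lt_min ltr01 divr_gt0//= ge_min lexx.
have [e0 e1] := andP e01.
have CKe : Cf * (K * e) <= tau.
  rewrite mulrA; apply: (@le_trans _ _ ((Cf * K) * (tau / (Cf * K + 1)))).
    by rewrite ler_wpM2l ?mulr_ge0// ge_min lexx orbT.
  rewrite mulrCA ler_piMr ?(ltW tau0)//.
  by rewrite ler_pdivrMr// mul1r lerDl ler01.
have [k [k' [dk k0 k'0 Q0 QK]]] := HK e e01.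
have Ne0 : - e < 0 by rewrite oppr_lt0.
have [ig Ig] := radial_identity r10 r1r n2 r_le1 Ne0 hg dk k0 k'0.
have [i1 I1] := radial_identity r10 r1r n2 r_le1 Ne0 h1 dk k0 k'0.
pose p (x : 'rV[R]_n) := n%:R * k (dotp x x) + 2 * dotp x x * k' (dotp x x).
pose Q x := p x + 2 * beta (dotp x x).
have ip : mu.-integrable setT (EFin \o p).
  by apply: eq_integrable i1 => // x _; rewrite /= mul1r.
have Ip : I p = 0.
  rewrite /I /Rintegral -[RHS]/(fine 0%E) -I1; congr fine.
  by apply: eq_integral => x _; rewrite /= mul1r.
have i2 (h : 'rV[R]_n -> R) c : mu.-integrable setT (EFin \o h) ->
    mu.-integrable setT (EFin \o (fun x => c * h x)).
  by move=> ih; have := integrableZl measurableT c ih.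
have iD (h h' : 'rV[R]_n -> R) : mu.-integrable setT (EFin \o h) ->
    mu.-integrable setT (EFin \o h') ->
    mu.-integrable setT (EFin \o (fun x => h x + h' x)).
  by move=> ih ih'; have := integrableD measurableT ih ih'.
have iQ : mu.-integrable setT (EFin \o Q) by apply: iD => //; exact: i2.
have IQ : I Q = 2 * I (fun x => beta (dotp x x)).
  rewrite /I RintegralD//; last exact: i2.
  by rewrite -/(I p) Ip add0r RintegralZl.
have gQE : (fun x => g x * Q x) = (fun x => g x * p x + 2 * (beta (dotp x x) * g x)).
  by apply/funext => x; rewrite /Q; ring.
have igQ : mu.-integrable setT (EFin \o (fun x => g x * Q x)).
  by rewrite gQE; apply: iD => //; exact: i2.
have -> : 2 * J = I (fun x => g x * Q x).
  rewrite gQE /I RintegralD//; last exact: i2.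
  rewrite RintegralZl// -/J (_ : \int[mu]_x (g x * p x) = 0) ?add0r//.
  by rewrite /Rintegral Ig.
apply: le_trans (le_normr_Rintegral measurableT igQ) _.
rewrite mulrDr -IQ; have -> : tau * I Q + tau * I (\1_A) =
    I (fun x => tau * Q x + tau * \1_A x).
  by rewrite /I (RintegralD measurableT (i2 _ tau iQ) (i2 _ tau i_A)) !RintegralZl.
apply: le_Rintegral => //.
- by have := integrable_abse igQ.
- exact: iD (i2 _ _ iQ) (i2 _ _ i_A).
(* Beyond [r1] the weight [Q] vanishes; within [delta] the factor [g] is at most [tau]; in between
   [Q <= K * e], and the indicator of [A] pays for the resulting [tau]. *)
move=> x _; rewrite normrM (ger0_norm (Q0 _ (dotp_ge0 x))) -/(Q x).
have [xr|xr] := leP r1 (enorm x).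
  have Sx : r1 ^+ 2 <= dotp x x by rewrite big.
  have -> : Q x = 0 by rewrite /Q /p k0// k'0// bc// !mulr0 !addr0.
  by rewrite !mulr0 add0r mulr_ge0// ltW.
have [xd|xd] := ltP (enorm x) delta.
  rewrite -[leLHS]addr0 lerD ?mulr_ge0// ?(ltW tau0)//.
  by rewrite ler_wpM2r ?gdelta// Q0// dotp_ge0.
rewrite -[leLHS]add0r lerD ?mulr_ge0 ?(ltW tau0) ?Q0 ?dotp_ge0//.
rewrite indicE mem_set// mulr1; apply: le_trans CKe.
apply: ler_pM; rewrite ?Q0 ?dotp_ge0 ?gCf ?(ltW xr)//.
apply: QK; rewrite -sqr_enorm ler_pXn2r// nnegrE ?enorm_ge0//.
exact: ltW.
Qed.
(** * The test function *)

Section kuran_function.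
Context {R : realType} {n : nat}.
Variables (z : 'rV[R]_n) (d : R).
Hypotheses (n2 : (2 <= n)%N) (d0 : 0 < d) (dz : d < enorm z) (z1 : enorm z < 1).

(** A whole ball around the pole is removed, so that [t] stays above [d ^+ 2] and the test function
    is bounded. *)
Let U : set 'rV[R]_n := [set x | enorm x < 1 /\ d < enorm (x - z)].
Let Z := dotp z z.
Let v0 := (1 - Z)^-1.
Let t0 := Z * v0.
(** Equal to [1 + 2 * t0], the hyperbolic cosine of the distance from [0] to [z]. *)
Let kappa := 2 * v0 - 1.
Let q : R := - (n%:R / 2).
Let y (t : R) : R := (t + t ^+ 2) `^ q.
Let y1 (t : R) : R := q * (y t / (t + t ^+ 2)) * (1 + 2 * t).
Let y2 (t : R) : R := q * (y1 t * (1 + 2 * t) / (t + t ^+ 2) +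
  y t * (2 * (t + t ^+ 2) - (1 + 2 * t) ^+ 2) / (t + t ^+ 2) ^+ 2).
Let a := kappa * (n%:R / 2 * (1 + 2 * t0) / (1 + t0) - 1).
Let v (x : 'rV[R]_n) : R := (1 - dotp x x)^-1.
Let t (x : 'rV[R]_n) : R := v0 * (dotp (x - z) (x - z) * v x).

Let Z_gt0 : d ^+ 2 < Z.
Proof. by rewrite /Z -sqr_enorm ltr_pXn2r// nnegrE ?enorm_ge0// ltW. Qed.

Let Z_lt1 : Z < 1.
Proof. by rewrite /Z -sqr_enorm expr_lt1// enorm_ge0. Qed.

Let d2_gt0 : 0 < d ^+ 2. Proof. exact: exprn_gt0. Qed.

Let v0_ge1 : 1 <= v0.
Proof.
by rewrite /v0 invf_ge1 ?subr_gt0//; move: Z_gt0 d2_gt0; lra.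
Qed.

Let v0E : Z = 1 - v0^-1.
Proof. by rewrite /v0 invrK opprB addrC subrK. Qed.

Let t0_gt0 : d ^+ 2 < t0.
Proof.
apply: lt_le_trans Z_gt0 _; rewrite /t0 ler_peMr//.
by move: Z_gt0 d2_gt0; lra.
Qed.

Let t0E : v0 = 1 + t0.
Proof. by rewrite /t0 v0E; field; rewrite gt_eqF//; move: v0_ge1; lra. Qed.

Let tt_gt0 (s : R) : 0 < s -> 0 < s + s ^+ 2.
Proof. by move=> s0; rewrite addr_gt0// exprn_gt0. Qed.

Let dtt (s : R) : is_derive s 1 (fun s => s + s ^+ 2) (1 + 2 * s).
Proof.
apply: (is_derive_eq (is_deriveD (is_derive_id _ _) (is_deriveX 2 (is_derive_id s 1)))).
by rewrite expr1 [_ *: 1]mulr1.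
Qed.

Let dy (s : R) : 0 < s -> is_derive s 1 y (y1 s).
Proof.
by move=> s0; exact: (is_derive_dir_comp (dtt s) (is_derive_powR q (tt_gt0 s0))).
Qed.

Let dlin (s : R) : is_derive s 1 (fun s : R => 1 + 2 * s) 2.
Proof.
have h1 : is_derive s 1 (cst (1 : R)) 0 by exact: is_derive_cst.
have h2 : is_derive s 1 (cst (2 : R)) 0 by exact: is_derive_cst.
have h3 : is_derive s 1 (@id R) 1 by exact: is_derive_id.
apply: (is_derive_eq (is_deriveD h1 (is_deriveM h2 h3))).
by rewrite add0r [s *: 0]mulr0 addr0 [_ *: 1]mulr1.
Qed.

Let dy1 (s : R) : 0 < s -> is_derive s 1 y1 (y2 s).
Proof.
move=> s0; have s1 := tt_gt0 s0.
have i1 : is_derive s 1 (fun s : R => (s + s ^+ 2)^-1) (- (s + s ^+ 2) ^- 2 *: (1 + 2 * s)).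
  by apply: is_deriveV; rewrite ?gt_eqF.
have i2 := is_deriveM (is_deriveM (is_derive_cst q s 1) (is_deriveM (dy s0) i1)) (dlin s).
apply: (is_derive_eq i2).
transitivity (q * (y s * (s + s ^+ 2)^-1) * 2 + (1 + 2 * s) *
  (q * (y s * (- (s + s ^+ 2) ^- 2 * (1 + 2 * s)) + (s + s ^+ 2)^-1 * y1 s) +
   y s * (s + s ^+ 2)^-1 * 0)); first by [].
by rewrite /y2 /y1; field; rewrite gt_eqF.
Qed.

Let cy2 (s : R) : 0 < s -> {for s, continuous y2}.
Proof.
move=> s0; have s1 := tt_gt0 s0.
have ctt : {for s, continuous (fun s : R => s + s ^+ 2)}.
  exact: is_derive_continuous (dtt s).
have clin := is_derive_continuous (dlin s).
have ctV : {for s, continuous (fun s : R => (s + s ^+ 2)^-1)}.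
  by apply: continuousV => //; rewrite gt_eqF.
apply: continuousM; first exact: cst_continuous.
apply: continuousD.
  apply: continuousM ctV; apply: continuousM clin.
  exact: is_derive_continuous (dy1 s0).
apply: continuousM.
  apply: continuousM; first exact: is_derive_continuous (dy s0).
  apply: continuousB.
    by apply: continuousM ctt; exact: cst_continuous.
  by apply: (@continuous_comp _ _ _ (fun s : R => 1 + 2 * s) (fun s => s ^+ 2)) => //;
    exact: exprn_continuous.
apply: continuousV; first by rewrite expf_neq0// gt_eqF.
by apply: (@continuous_comp _ _ _ (fun s : R => s + s ^+ 2) (fun s => s ^+ 2)) => //;
  exact: exprn_continuous.
Qed.

Let vP (x : 'rV[R]_n) : enorm x < 1 -> 0 < 1 - dotp x x.
Proof. by move=> x1; rewrite subr_gt0 -sqr_enorm expr_lt1// enorm_ge0. Qed.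

Let v_ge1 (x : 'rV[R]_n) : enorm x < 1 -> 1 <= v x.
Proof.
by move=> /vP x1; rewrite /v invf_ge1//; have := dotp_ge0 x; lra.
Qed.

Let t_ge (x : 'rV[R]_n) : enorm x < 1 -> dotp (x - z) (x - z) <= t x.
Proof.
move=> /v_ge1 vx; rewrite /t mulrCA ler_peMr ?dotp_ge0//.
by rewrite mulr_ege1.
Qed.

Let t_gt x : U x -> d ^+ 2 < t x.
Proof.
move=> [x1 xz]; apply: lt_le_trans (t_ge x1).
by rewrite -sqr_enorm ltr_pXn2r// nnegrE ?enorm_ge0// ltW.
Qed.

Variable g : R -> R.
Hypothesis dg : forall s, d ^+ 2 / 2 < s -> is_derive s 1 g (- y s).

(* [kappa t - (v - v0)] is the derivative of [t] under [z . grad_z]. *)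
Let F (x : 'rV[R]_n) : R := a * g (t x) - y (t x) * (kappa * t x - (v x - v0)).

(** [tau] is the gradient of [t]. With [F] seen as a function of [t] and [v], [P] is its partial
    derivative in [t] and [y (t x)] the one in [v], which gives [dF] by the chain rule. *)
Let tau (i : 'I_n) (x : 'rV[R]_n) : R :=
  2 * v0 * v x * (x ord0 i - z ord0 i) + 2 * t x * v x * x ord0 i.
Let P (x : 'rV[R]_n) : R := - a * y (t x) - y1 (t x) * (kappa * t x - (v x - v0)) - kappa * y (t x).
Let dF (i : 'I_n) (x : 'rV[R]_n) : R := P x * tau i x + 2 * (y (t x) * (v x * v x) * x ord0 i).

Let cv : C1_grad U v (fun i x => 2 * (v x * v x) * x ord0 i).
Proof.
have h x : U x -> is_derive (dotp x x) 1 (fun s : R => (1 - s)^-1)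
    ((fun s : R => (1 - s) ^- 2) (dotp x x)) /\
    {for dotp x x, continuous (fun s : R => (1 - s) ^- 2)}.
  move=> [/vP x1 _]; have x0 : 1 - dotp x x != 0 by rewrite gt_eqF.
  have dl : is_derive (dotp x x) 1 (fun s : R => 1 - s) (- 1).
    by apply: (is_derive_eq (is_deriveB (is_derive_cst _ _ _) (is_derive_id _ _))); rewrite sub0r.
  split.
    by apply: (is_derive_eq (is_deriveV (f := fun s : R => 1 - s) x0 dl));
      rewrite scalerN scaleNr opprK [_ *: _]mulr1.
  apply: continuousV; first by rewrite expf_neq0.
  apply: (@continuous_comp _ _ _ (fun s : R => 1 - s) (fun s => s ^+ 2)).
    exact: is_derive_continuous dl.
  exact: exprn_continuous.
apply: C1_eq (C1_comp (C1_dotp (U := U)) h) => // i x.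
by rewrite /v; rewrite -exprVn; ring.
Qed.

Let ct : C1_grad U t tau.
Proof.
apply: C1_eq (C1Z v0 (C1M (C1_dotpB (U := U) z) cv)) => // i x.
by rewrite /tau /t; ring.
Qed.

Let tpos x : U x -> 0 < t x.
Proof. by move=> /t_gt; apply: lt_trans. Qed.

Let cy : C1_grad U (fun x => y (t x)) (fun i x => y1 (t x) * tau i x).
Proof.
apply: (C1_comp ct) => x /tpos x0; split; first exact: dy.
exact: is_derive_continuous (dy1 x0).
Qed.

Let cy1 : C1_grad U (fun x => y1 (t x)) (fun i x => y2 (t x) * tau i x).
Proof.
by apply: (C1_comp ct) => x /tpos x0; split; [exact: dy1|exact: cy2].
Qed.

Let cg : C1_grad U (fun x => g (t x)) (fun i x => - y (t x) * tau i x).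
Proof.
apply: (C1_comp (g' := fun s => - y s) ct) => x Ux; have x0 := tpos Ux; split.
  by apply: dg; have := t_gt Ux; move: d2_gt0; lra.
by apply: continuousN; exact: is_derive_continuous (dy x0).
Qed.

Let cm : C1_grad U (fun x => kappa * t x - (v x - v0))
  (fun i x => kappa * tau i x - 2 * (v x * v x) * x ord0 i).
Proof.
by apply: C1_eq (C1B (C1Z kappa ct) (C1B cv (C1_cst v0))) => // i x; rewrite subr0.
Qed.

Let cF : C1_grad U F dF.
Proof.
by apply: C1_eq (C1B (C1Z a cg) (C1M cy cm)) => // i x; rewrite /dF /P; ring.
Qed.

Let dP (i : 'I_n) (x : 'rV[R]_n) : R :=
  (- (a + 2 * kappa) * y1 (t x) - y2 (t x) * (kappa * t x - (v x - v0))) * tau i x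
  + 2 * y1 (t x) * (v x * v x) * x ord0 i.

Let cP : C1_grad U P dP.
Proof.
apply: C1_eq (C1B (C1B (C1Z (- a) cy) (C1M cy1 cm)) (C1Z kappa cy)) => // i x.
by rewrite /dP; ring.
Qed.

(** The formula for the derivatives is left to unification with the rules; only the trace of the
    second derivatives is simplified, in the next lemma. *)
Let ctau i : C1_grad U (tau i) _ :=
  C1D (C1M (C1Z (2 * v0) cv) (C1B (C1_coord i) (C1_cst (z ord0 i))))
      (C1M (C1M (C1Z 2 ct) cv) (C1_coord i)).

Let cdF i : C1_grad U (dF i) _ :=
  C1D (C1M cP (ctau i)) (C1Z 2 (C1M (C1M cy (C1M cv cv)) (C1_coord i))).

(** The Laplacian and [x . grad F] involve [x] only through [A = |x - z|^2], [X = x . (x - z)] and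
    [S = |x|^2], all rational in [t], [v] and [v0]. As [y1] and [y2] are rational multiples of [y],
    harmonicity becomes a rational identity. It holds for every value of [a]. *)
Lemma kuran_grad : exists dF ddF,
  [/\ C1_grad U F dF, forall i, C1_grad U (dF i) (ddF i) &
   forall x, U x -> (1 - dotp x x) * (\sum_(i < n) ddF i i x) +
     2 * (n%:R - 2) * (\sum_(i < n) x ord0 i * dF i x) = 0].
Proof.
exists dF; eexists; split; [exact: cF|move=> i; exact: cdF|].
move=> x Ux.
have x0 : t x != 0 by rewrite gt_eqF// tpos.
have tx1 : t x + t x ^+ 2 != 0 by rewrite gt_eqF// tt_gt0// tpos.
have vx0 : v x != 0 by rewrite gt_eqF//; have := v_ge1 Ux.1; lra.
have v00 : v0 != 0 by rewrite gt_eqF//; move: v0_ge1; lra.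
set A := dotp (x - z) (x - z); set S := dotp x x.
pose X := (A + S - Z) / 2.
have XE : \sum_(i < n) x ord0 i * (x ord0 i - z ord0 i) = X.
  rewrite /X /A dotpBB -/S -/Z.
  transitivity (S - dotp x z); last by field.
  by rewrite /S /dotp -sumrB; apply: eq_bigr => i _; rewrite mulrBr.
have AE : \sum_(i < n) (x ord0 i - z ord0 i) * (x ord0 i - z ord0 i) = A.
  by apply: eq_bigr => i _; rewrite !mxE.
pose Pt := - (a + 2 * kappa) * y1 (t x) - y2 (t x) * (kappa * t x - (v x - v0)).
pose c1 := P x * (2 * v x * v0 + 2 * t x * v x) + 2 * y (t x) * v x ^+ 2.
pose c2 := 4 * Pt * v x ^+ 2 * v0 ^+ 2.
pose c3 := 8 * Pt * t x * v x ^+ 2 * v0 + 8 * y1 (t x) * v x ^+ 3 * v0 +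
  8 * P x * v x ^+ 2 * v0.
pose c4 := 4 * Pt * t x ^+ 2 * v x ^+ 2 + 8 * y1 (t x) * v x ^+ 3 * t x +
  8 * P x * t x * v x ^+ 2 + 8 * y (t x) * v x ^+ 3.
have -> : \sum_(i < n) x ord0 i * dF i x =
    2 * P x * v x * v0 * X + (2 * P x * t x * v x + 2 * y (t x) * v x ^+ 2) * S.
  rewrite -XE /S /dotp !mulr_sumr -big_split/=; apply: eq_bigr => i _.
  by rewrite /dF /tau; ring.
rewrite (_ : \sum_(i < n) _ = n%:R * c1 + c2 * A + c3 * X + c4 * S); last first.
  rewrite -AE -XE /S /dotp !mulr_sumr.
  rewrite (_ : n%:R * c1 = \sum_(i < n) c1); last first.
    by rewrite sumr_const card_ord mulr_natl.
  rewrite -!big_split/=; apply: eq_bigr => i _.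
  rewrite eqxx (_ : true%:R = 1 :> R)// /dP -/Pt /c1 /c2 /c3 /c4 /tau; ring.
have SE : S = 1 - (v x)^-1 by rewrite /v invrK opprB addrC subrK.
have AtE : A = t x / (v0 * v x) by rewrite /t -/A; field; rewrite vx0.
rewrite /X AtE SE v0E /c1 /c2 /c3 /c4 /Pt /P /y2 /y1 /q /kappa.
by field; rewrite vx0 tx1 v00.
Qed.

Let y_ge0 s : 0 <= y s. Proof. exact: powR_ge0. Qed.

Let y_nincr s s' : 0 < s -> s <= s' -> y s' <= y s.
Proof.
move=> s0 ss'; rewrite /y /q !powRN lef_pV2 ?posrE ?powR_gt0 ?tt_gt0 ?(lt_le_trans s0)//.
have s'0 := lt_le_trans s0 ss'.
apply: ge0_ler_powR; rewrite ?nnegrE ?divr_ge0 ?(ltW (tt_gt0 _))//.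
by rewrite lerD// ler_pXn2r// nnegrE ltW.
Qed.

Let kappa_gt0 : 0 < kappa. Proof. by rewrite /kappa; move: v0_ge1; lra. Qed.

Let n2R : 1 <= n%:R / 2 :> R.
Proof. by rewrite ler_pdivlMr// mul1r ler_nat. Qed.

Let a_ge0 : 0 <= a.
Proof.
have t00 : 0 < t0 by apply: lt_trans t0_gt0.
rewrite /a mulr_ge0 ?(ltW kappa_gt0)// subr_ge0.
rewrite ler_pdivlMr; last by lra.
by rewrite mul1r; apply: (@le_trans _ _ (1 * (1 + 2 * t0))); [lra|rewrite ler_wpM2r//; lra].
Qed.

(* [a] is chosen so that the derivative of [Phi] vanishes exactly at [t0]. *)
Let Phi (s : R) : R := a * g s - kappa * s * y s.

Let phi (s : R) : R := y s * kappa * (n%:R / 2) * (s - t0) / ((1 + s) * (1 + t0)).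

Let dPhi (s : R) : d ^+ 2 / 2 < s -> is_derive s 1 Phi (phi s).
Proof.
move=> ds; have s0 : 0 < s by move: d2_gt0; lra.
have t00 : 0 < t0 by apply: lt_trans t0_gt0.
have h1 : is_derive s 1 (cst a) 0 by exact: is_derive_cst.
have h2 : is_derive s 1 (cst kappa) 0 by exact: is_derive_cst.
have h3 : is_derive s 1 (@id R) 1 by exact: is_derive_id.
apply: (is_derive_eq (is_deriveB (is_deriveM h1 (dg ds))
  (is_deriveM (is_deriveM h2 h3) (dy s0)))).
transitivity (a * (- y s) + g s * 0 -
  (kappa * s * y1 s + y s * (kappa * 1 + s * 0))); first by [].
rewrite /y1 /q /a /phi; field.
by rewrite !gt_eqF ?tt_gt0//; lra.
Qed.

Let Phi_min s : d ^+ 2 < s -> Phi t0 <= Phi s.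
Proof.
move=> ds; have s0 : 0 < s by move: d2_gt0; lra.
have t00 := t0_gt0; have d20 := d2_gt0.
have [ts|st] := leP t0 s.
  apply: (@is_derive_ge0_le _ Phi phi _ _ ts) => u /andP[tu us]; first by apply: dPhi; lra.
  by rewrite divr_ge0 ?mulr_ge0 ?y_ge0 ?(ltW kappa_gt0)//; lra.
rewrite -lerN2.
apply: (@is_derive_ge0_le _ (fun s => - Phi s)
    (fun s => - phi s) _ _ (ltW st)) => u /andP[su ut].
  by apply: is_deriveN; apply: dPhi; lra.
rewrite /phi -mulNr -mulrN opprB.
by rewrite divr_ge0 ?mulr_ge0 ?y_ge0 ?(ltW kappa_gt0)//; lra.
Qed.

Let F0 : F 0 = Phi t0 - t0 * y t0.
Proof.
have t0t : t 0 = t0.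
  rewrite /t /v sub0r -sqr_enorm enormN sqr_enorm -/Z -sqr_enorm enorm0.
  by rewrite expr0n/= subr0 invr1 mulr1 mulrC.
rewrite /F t0t /Phi /v -sqr_enorm enorm0 expr0n/= subr0 invr1 t0E; ring.
Qed.

(** The part depending on [t] alone is minimal at [t0], the value of [t] at the origin; the other
    part has the sign of [|x| - |z|]. At the origin the latter equals [- t0 * y t0], and this
    deficit is the gap. *)
Let FE x : F x = Phi (t x) + y (t x) * (v x - v0).
Proof. by rewrite /F /Phi; ring. Qed.

Lemma kuran_ge x : U x -> enorm z <= enorm x -> F 0 + t0 * y t0 <= F x.
Proof.
move=> Ux zx; rewrite F0 subrK FE -[leLHS]addr0 lerD ?Phi_min ?t_gt//.
rewrite mulr_ge0// subr_ge0 /v0 /v lef_pV2 ?posrE ?subr_gt0 ?Z_lt1//.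
  by rewrite lerD2l lerN2 /Z -!sqr_enorm ler_pXn2r// nnegrE enorm_ge0.
by rewrite -subr_gt0; apply: vP; case: Ux.
Qed.

Let y_le_pot x : U x -> y (t x) <= enorm (x - z) ^- n.
Proof.
move=> Ux; have xz0 : 0 < enorm (x - z) by apply: lt_trans Ux.2.
have A0 : 0 < dotp (x - z) (x - z) by rewrite -sqr_enorm exprn_gt0.
rewrite /y /q powRN lef_pV2 ?posrE ?exprn_gt0 ?powR_gt0 ?tt_gt0 ?tpos//.
have -> : enorm (x - z) ^+ n = dotp (x - z) (x - z) `^ (n%:R / 2).
  have -> : dotp (x - z) (x - z) = enorm (x - z) `^ 2%:R.
    by rewrite powR_mulrn ?enorm_ge0// sqr_enorm.
  rewrite -powRrM mulrC divfK ?pnatr_eq0//.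
  by rewrite powR_mulrn// enorm_ge0.
apply: ge0_ler_powR; rewrite ?nnegrE ?divr_ge0 ?dotp_ge0 ?(ltW (tt_gt0 (tpos Ux)))//.
by rewrite (le_trans (t_ge Ux.1))// lerDl sqr_ge0.
Qed.

(** [y (t x)] is singular like [|x - z|^(- n)], but it is multiplied by [v0 - v = (Z - |x|^2) v v0],
    which vanishes on the sphere [|x| = |z|]: as [Z - |x|^2 <= 2 |x - z|], one power is gained and
    the singularity becomes integrable. *)
Lemma kuran_ge_inside x : U x -> enorm x < enorm z ->
  F 0 + t0 * y t0 - 2 * v0 ^+ 2 * enorm (x - z) ^- n.-1 <= F x.
Proof.
move=> Ux xz; rewrite F0 subrK FE lerD ?Phi_min ?t_gt//.
have e0 : 0 < enorm (x - z) by apply: lt_trans Ux.2.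
have SZ : dotp x x < Z by rewrite /Z -!sqr_enorm ltr_pXn2r// nnegrE enorm_ge0.
have vx : v x <= v0.
  by rewrite /v /v0 lef_pV2 ?posrE ?subr_gt0 ?Z_lt1 ?(lt_trans SZ)// lerD2l lerN2 ltW.
have v1 := v_ge1 Ux.1; have v01 := v0_ge1.
have vE : v0 - v x = (Z - dotp x x) * (v x * v0).
  by rewrite /v /v0; field; rewrite !gt_eqF ?subr_gt0 ?Z_lt1 ?(lt_trans SZ)//; exact: Z_lt1.
have SZe : Z - dotp x x <= 2 * enorm (x - z).
  rewrite /Z -!sqr_enorm subr_sqr mulrC; apply: ler_pM.
  - by rewrite addr_ge0 ?enorm_ge0.
  - by rewrite subr_ge0 ltW.
  - by have := enorm_ge0 x; move: z1 xz; lra.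
  - by rewrite enormBC enormB_ge.
rewrite -(opprB v0 (v x)) mulrN lerN2.
have -> : enorm (x - z) ^- n.-1 = enorm (x - z) ^- n * enorm (x - z).
  have nE : n = n.-1.+1 by rewrite prednK// ltnW.
  rewrite (_ : enorm (x - z) ^+ n = enorm (x - z) ^+ n.-1 * enorm (x - z)).
    by rewrite invfM mulrVK// unitfE gt_eqF.
  by rewrite -exprSr -nE.
rewrite (_ : 2 * _ * _ = enorm (x - z) ^- n * (2 * enorm (x - z) * (v0 * v0))); last by ring.
rewrite vE; apply: ler_pM; rewrite ?y_le_pot// ?mulr_ge0 ?subr_ge0 ?(ltW SZ)//; try lra.
apply: ler_pM; rewrite ?mulr_ge0 ?subr_ge0 ?(ltW SZ)//; try lra.
by rewrite ler_wpM2r//; lra.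
Qed.

(** On [U] the function [v] still blows up at the unit sphere, but [v <= t / d ^+ 2], and [y t * t]
    stays bounded because the exponent [n / 2] is at least [1]. Boundedness is what makes [F]
    integrable on a domain of finite measure. *)
Lemma kuran_bounded : exists M, forall x, U x -> `|F x| <= M.
Proof.
pose M1 := a * g (d ^+ 2) + (1 + y (d ^+ 2)) / d ^+ 2.
pose M2 := Phi t0 - y (d ^+ 2) * v0.
exists (`|M1| + `|M2|) => x Ux; have tx := t_gt Ux; have d20 := d2_gt0.
have v1 := v_ge1 Ux.1; have v01 := v0_ge1; have k0 := kappa_gt0.
have yx : y (t x) <= y (d ^+ 2) by apply: y_nincr => //; exact: ltW.
suff [h1 h2] : F x <= M1 /\ M2 <= F x.
  rewrite ler_norml; apply/andP; split.
    have := ler_norm (- M2); rewrite normrN; have := normr_ge0 M1; lra.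
  by have := ler_norm M1; have := normr_ge0 M2; lra.
split; last first.
  rewrite FE /M2; apply: lerD; first exact: Phi_min.
  apply: (@le_trans _ _ (y (t x) * - v0)).
    by rewrite mulrN lerN2 ler_wpM2r//; lra.
  by rewrite ler_wpM2l//; lra.
have gx : g (t x) <= g (d ^+ 2).
  rewrite -lerN2; apply: (@is_derive_ge0_le _ (fun s => - g s) y) => //.
  - exact: ltW.
  - move=> u /andP[du _]; rewrite -[y u]opprK; apply: is_deriveN; apply: dg; lra.
have ytx : y (t x) * t x <= 1 + y (d ^+ 2).
  have t0x := tpos Ux; have tt := tt_gt0 t0x.
  have [tt1|tt1] := leP 1 (t x + t x ^+ 2).
    apply: (@le_trans _ _ 1); last by rewrite lerDl.
    rewrite /y /q powRN mulrC ler_pdivrMr ?powR_gt0// mul1r.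
    apply: (@le_trans _ _ ((t x + t x ^+ 2) `^ 1)).
      by rewrite powRr1 ?(ltW tt)// lerDl sqr_ge0.
    by rewrite ler_powR.
  apply: (@le_trans _ _ (y (d ^+ 2) * 1)); last by rewrite mulr1 lerDr.
  apply: ler_pM => //; first exact: ltW.
  by have := sqr_ge0 (t x); lra.
have vt : v x <= t x / d ^+ 2.
  rewrite ler_pdivlMr// /t [leRHS]mulrA [leLHS]mulrC; apply: ler_wpM2r; first lra.
  have dA : d ^+ 2 <= dotp (x - z) (x - z).
    by rewrite -sqr_enorm ler_pXn2r ?nnegrE ?enorm_ge0 ?ltW//; case: Ux.
  by apply: le_trans dA _; rewrite ler_peMl// dotp_ge0.
rewrite /F /M1.
apply: lerD; first by rewrite ler_wpM2l.
apply: (@le_trans _ _ (y (t x) * (t x / d ^+ 2))); last first.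
  by rewrite mulrA ler_wpM2r// invr_ge0 ltW.
rewrite -mulrN ler_wpM2l//.
have : 0 <= kappa * t x by rewrite mulr_ge0 ?ltW// tpos.
by lra.
Qed.

End kuran_function.

Lemma kuran_function_exists (R : realType) n (z : 'rV[R]_n) (d : R) :
  (2 <= n)%N -> 0 < d -> d < enorm z -> enorm z < 1 ->
  let U := [set x | enorm x < 1 /\ d < enorm (x - z)] in
  let v0 := (1 - dotp z z)^-1 in
  let t0 := dotp z z * v0 in
  let delta := t0 * (t0 + t0 ^+ 2) `^ (- (n%:R / 2)) in
  exists (F : 'rV[R]_n -> R) dF ddF,
  [/\ [/\ C1_grad U F dF, forall i, C1_grad U (dF i) (ddF i) &
        forall x, U x -> (1 - dotp x x) * (\sum_(i < n) ddF i i x) +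
          2 * (n%:R - 2) * (\sum_(i < n) x ord0 i * dF i x) = 0],
      forall x, U x -> enorm z <= enorm x -> F 0 + delta <= F x,
      forall x, U x -> enorm x < enorm z ->
        F 0 + delta - 2 * v0 ^+ 2 * enorm (x - z) ^- n.-1 <= F x &
      exists M, forall x, U x -> `|F x| <= M].
Proof.
move=> n2 d0 dz z1 U v0 t0 delta.
(* Only the derivative of the radial profile is used, so any antiderivative serves; starting at
   [d ^+ 2 / 2] keeps the endpoint strictly below the values of [t] on [U]. *)
have [g dg] : exists g : R -> R, forall s, d ^+ 2 / 2 < s ->
    is_derive s 1 g (- (s + s ^+ 2) `^ (- (n%:R / 2))).
  apply: antiderivative => s ds.
  have s0 : 0 < s by apply: lt_le_trans ds; rewrite divr_gt0// exprn_gt0.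
  have ss0 : 0 < s + s ^+ 2 by rewrite addr_gt0// exprn_gt0.
  apply: continuousN.
  apply: (@continuous_comp _ _ _ (fun s : R => s + s ^+ 2) (fun t => t `^ _)).
    by apply: continuousD; [exact: cvg_id|exact: exprn_continuous].
  exact: is_derive_continuous (is_derive_powR _ ss0).
have [dF [ddF H]] := kuran_grad d0 dz z1 dg.
do 3 eexists; split; first exact: H.
- by move=> x; apply: kuran_ge.
- by move=> x; apply: kuran_ge_inside.
- exact: kuran_bounded.
Qed.
(** * Volume estimates *)

Lemma hyp_density_ge1 (R : realType) n (x : 'rV[R]_n) :
  unit_ball R n x -> 1 <= hyp_density x.
Proof.
rewrite unit_ballE /= => x1; rewrite /hyp_density invf_ge1; last first.
  by rewrite exprn_gt0// subr_gt0.
by rewrite exprn_ile1 ?subr_ge0 ?(ltW x1)// lerBlDr lerDl sqr_ge0.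
Qed.

Lemma hyp_density_le (R : realType) n (x : 'rV[R]_n) r : r < 1 -> enorm x <= r ->
  hyp_density x <= (1 - r ^+ 2) ^- n.
Proof.
move=> r1 xr; have r0 : 0 <= r := le_trans (enorm_ge0 x) xr.
have r2 : 0 < 1 - r ^+ 2 by rewrite subr_gt0 expr_lt1.
have x2 : 1 - r ^+ 2 <= 1 - enorm x ^+ 2.
  by rewrite lerD2l lerN2 ler_pXn2r// nnegrE enorm_ge0.
rewrite /hyp_density lef_pV2 ?posrE ?exprn_gt0 ?(lt_le_trans r2)//.
by rewrite lerXn2r// nnegrE ltW// (lt_le_trans r2).
Qed.

Lemma nu_density (R : realType) n (D : set 'rV[R]_n) :
  measurable D -> D `<=` unit_ball R n ->
  nu R n D = (\int[lebesgue_rV R n]_(x in D) (hyp_density x)%:E)%E.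
Proof. by move=> mD DB; rewrite /nu setIidl. Qed.

Lemma measurable_hyp_densityW (R : realType) n (D : set 'rV[R]_n) :
  D `<=` unit_ball R n -> measurable_fun D (fun x => (hyp_density x)%:E).
Proof.
move=> DB; apply/measurable_EFinP.
by apply: measurable_funS measurable_hyp_density => //; exact: measurable_unit_ball.
Qed.

Lemma nu_ge_lebesgue (R : realType) n (D : set 'rV[R]_n) (c : R) : 0 <= c ->
  measurable D -> D `<=` unit_ball R n -> (forall x, D x -> c <= hyp_density x) ->
  (c%:E * lebesgue_rV R n D <= nu R n D)%E.
Proof.
move=> c0 mD DB Dc; rewrite nu_density// -integral_cst//.
by apply: ge0_le_integral => //; exact: measurable_hyp_densityW.
Qed.

Lemma enorm_delta (R : realType) n (i : 'I_n) (c : R) :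
  enorm (c *: delta_mx ord0 i : 'rV[R]_n) = `|c|.
Proof.
rewrite /enorm dotpZl dotpZr mulrA -expr2 /dotp (bigD1 i)//= big1 => [|j ji].
  by rewrite !mxE !eqxx/= mulr1 addr0 mulr1 sqrtr_sqr.
by rewrite !mxE (negbTE ji) andbF mulr0.
Qed.

(* The cube of half-side [e / n] around the point at distance [2 e] from the
   sphere has Euclidean volume of order [e ^ n] and density of order [e ^ -n]. *)
Lemma nu_shell_ge (R : realType) n (e : R) : (0 < n)%N -> 0 < e -> 3 * e < 1 ->
  (((3 * n%:R) ^- n)%:E <=
    nu R n (unit_ball R n `&` [set x | (1 - 4 * e < enorm x)%R]))%E.
Proof.
case: n => // m _ e0 e1; set n := m.+1.
pose p : 'rV[R]_n := (1 - 2 * e) *: delta_mx ord0 ord0.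
have n0 : (0 : R) < n%:R by rewrite ltr0n.
have en0 : 0 < e / n%:R by rewrite divr_gt0.
pose Q : set 'rV[R]_n := ball p (e / n%:R).
have pE : enorm p = 1 - 2 * e by rewrite /p enorm_delta gtr0_norm//; lra.
have QE x : Q x -> 1 - 3 * e <= enorm x <= 1 - e.
  rewrite /Q -ball_normE /= => px.
  have : enorm (p - x) <= e.
    by apply: le_trans (enorm_le_norm _) _; rewrite mulrC -ler_pdivlMr// ltW.
  have := enormB_ge p x; have := enormB_ge x p; rewrite (enormBC x p) pE.
  by move=> h1 h2 h3; apply/andP; split; lra.
have mQ : measurable Q by exact: measurable_ball_rV.
have QB : Q `<=` unit_ball R n.
  by move=> x Qx; have /andP[_ x1] := QE x Qx; rewrite /unit_ball/=; lra.
have e6 : 0 < 6 * e by lra.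
apply: (@le_trans _ _ (nu R n Q)); last first.
  apply: le_measure; rewrite ?inE//.
    apply: measurableI; first exact: measurable_unit_ball.
    by apply: open_measurable_rV; exact: open_enorm_gt.
  by move=> x Qx; split; [exact: QB|have /andP[] := QE _ Qx => /=; lra].
apply: le_trans (@nu_ge_lebesgue R n Q ((6 * e) ^- n) _ mQ QB _).
- rewrite lebesgue_rV_ball// -EFinM lee_fin -!exprVn -exprMn.
  rewrite le_eqVlt; apply/orP; left; apply/eqP; congr (_ ^+ _).
  by field; rewrite !gt_eqF.
- by rewrite invr_ge0 exprn_ge0// ltW.
- move=> x Qx; have /andP[x1 x2] := QE x Qx; have xB := QB x Qx.
  have x0 := enorm_ge0 x.
  have h : 0 < 1 - enorm x ^+ 2 by move: xB; rewrite unit_ballE /= subr_gt0.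
  rewrite /hyp_density lef_pV2 ?posrE ?exprn_gt0//.
  rewrite lerXn2r ?nnegrE ?(ltW h) ?(ltW e6)//.
  nra.
Qed.

(** If the measure were finite, the shells [A k], which decrease to the empty set, would have
    measures tending to [0]; but each has measure at least [(3 n) ^ (- n)]. *)
Lemma nu_unit_ball (R : realType) n : (0 < n)%N -> nu R n (unit_ball R n) = +oo%E.
Proof.
move=> n0; apply: contrapT => /eqP; rewrite -ltey => nuB.
pose A k := unit_ball R n `&` [set x | 1 - k.+1%:R^-1 < enorm x].
have mA k : measurable (A k).
  apply: measurableI; first exact: measurable_unit_ball.
  by apply: open_measurable_rV; exact: open_enorm_gt.
have A0 : \bigcap_k A k = set0.
  rewrite -subset0 => x Ax; have [x1 _] := Ax 0%N I.
  have x0 : 0 < 1 - enorm x by rewrite subr_gt0.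
  have [k _ /(_ _ (leqnn k)) /= kx] := near_infty_natSinv_lt (PosNum x0).
  have [_ /=] := Ax k I; set kk := _^-1 in kx *; move: kk kx => kk; lra.
have : nu R n (A k) @[k --> \oo] --> nu R n (\bigcap_k A k).
  apply: nonincreasing_cvg_mu => //.
  - apply: le_lt_trans nuB; apply: le_measure; rewrite ?inE//; first exact: measurable_unit_ball.
    by move=> x [].
  - exact: bigcap_measurable.
  - move=> i j ij; apply/subsetPset => x [x1 /= jx]; split=> //=.
    apply: le_lt_trans jx; rewrite lerD2l lerN2 lef_pV2 ?posrE//.
    by rewrite ler_nat.
rewrite A0 measure0 => /fine_cvgP[_] /cvgrPdist_lt.
have c0 : 0 < (3 * n%:R) ^- n :> R by rewrite invr_gt0 exprn_gt0// mulr_gt0// ltr0n.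
move=> /(_ _ c0) [N _ /(_ N (leqnn N))] /=.
rewrite sub0r normrN ltNge => /negP; apply.
(* With [e = 1 / (4 (N + 1))] the radius [1 - 4 e] is the inner radius of [A N]. *)
have N0 : 0 < (4 * N.+1%:R : R)^-1 by rewrite invr_gt0 mulr_gt0.
have N1 : 3 * (4 * N.+1%:R : R)^-1 < 1.
  rewrite -ltr_pdivlMl// mulr1 ltf_pV2 ?posrE ?mulr_gt0//.
  by rewrite (@lt_le_trans _ _ 4)// ?ltr_nat// ler_peMr// ler1n.
have := nu_shell_ge n0 N0 N1.
rewrite invfM mulrA mulfV ?mul1r// => h.
apply: le_trans (ler_norm _); rewrite -lee_fin fineK//.
rewrite ge0_fin_numE ?measure_ge0//; apply: le_lt_trans nuB.
by apply: le_measure; rewrite ?inE//; [exact: measurable_unit_ball|move=> x []].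
Qed.

(** Continuity from above: the annuli decrease to the sphere, a null set. The denominators [k.+2]
    keep the half-widths strictly below [r]. *)
Lemma annulus_small (R : realType) n (r tau : R) : (0 < n)%N -> 0 < r -> 0 < tau ->
  exists2 e, 0 < e & e < r /\
    (lebesgue_rV R n [set x | ((r - e <= enorm x) && (enorm x < r + e))%R] <= tau%:E)%E.
Proof.
move=> n0 r0 tau0.
pose e k : R := r / k.+2%:R.
have e0 k : 0 < e k by rewrite divr_gt0.
have er k : e k < r by rewrite ltr_pdivrMr// ltr_pMr// ltr1n.
pose A k := [set x : 'rV[R]_n | (r - e k <= enorm x) && (enorm x < r + e k)].
have mA k : measurable (A k).
  rewrite (_ : A k = ~` [set x | enorm x < r - e k] `&` [set x | enorm x < r + e k]).
    apply: measurableI; last by apply: open_measurable_rV; exact: open_enorm_lt.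
    by apply: measurableC; apply: open_measurable_rV; exact: open_enorm_lt.
  apply/seteqP; split=> x /=; first by case/andP => h1 h2; split=> //; rewrite ltNge h1.
  by case=> /negP; rewrite -leNgt => h1 h2; apply/andP.
have AI : \bigcap_k A k `<=` [set x | enorm x = r].
  move=> x Ax /=; apply/eqP; rewrite eq_sym -subr_eq0 -normr_le0.
  apply/ler_addgt0Pr => d d0; rewrite add0r.
  have dr : 0 < d / r by rewrite divr_gt0.
  have [k _ /(_ _ (leqnn k)) /= kx] := near_infty_natSinv_lt (PosNum dr).
  have ekd : e k <= d.
    rewrite /e mulrC -ler_pdivlMr//; apply: le_trans (ltW kx).
    by rewrite lef_pV2 ?posrE// ler_nat.
  have /andP[h1 h2] := Ax k I; rewrite ler_norml; apply/andP; split; lra.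
have bd : (lebesgue_rV R n (A 0%N) < +oo)%E.
  apply: (@le_lt_trans _ _ (lebesgue_rV R n (ball (0 : 'rV[R]_n) (2 * r)))).
    apply: le_measure; rewrite ?inE//; first exact: measurable_ball_rV.
    move=> x /andP[_ xr]; rewrite -ball_normE /= sub0r normrN.
    by apply: le_lt_trans (norm_le_enorm x) _; have := er 0%N; lra.
  by rewrite lebesgue_rV_ball ?ltry// mulr_gt0.
have A0 : lebesgue_rV R n (\bigcap_k A k) = 0%E.
  apply: (@subset_measure0 _ _ _ (lebesgue_rV R n) _ [set x | enorm x = r]) => //.
  - exact: bigcap_measurable.
  - apply: closed_measurable_rV.
    apply: (@closed_comp _ _ (@enorm R n) [set r]); last exact: closed_eq.
    by move=> x _; exact: continuous_enorm.
  - exact: lebesgue_rV_sphere.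
have : lebesgue_rV R n (A k) @[k --> \oo] --> lebesgue_rV R n (\bigcap_k A k).
  apply: nonincreasing_cvg_mu => //; first exact: bigcap_measurable.
  move=> i j ij; apply/subsetPset => x /andP[h1 h2] /=.
  have eij : e j <= e i by rewrite ler_pM2l// lef_pV2 ?posrE// ler_nat.
  by apply/andP; split; lra.
rewrite A0 => /fine_cvgP[[N1 _ fA]] /cvgrPdist_lt /(_ _ tau0)[N _ H].
exists (e (maxn N1 N)) => //; split=> //.
have := H (maxn N1 N) (leq_maxr _ _); have := fA (maxn N1 N) (leq_maxl _ _).
move=> fN /=; rewrite sub0r normrN => h.
by rewrite -(fineK fN) lee_fin; apply: le_trans (ltW h); exact: ler_norm.
Qed.

(** Splitting at distance [eta] from [z] gives a bound that ignores the position of [z]: the near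
    part is small with [eta], and for fixed [eta] the far part is small with the volume of [D]. *)
Lemma potential_le (R : realType) n (D : set 'rV[R]_n) (z : 'rV[R]_n) eta :
  (1 < n)%N -> 0 < eta -> measurable D ->
  (\int[lebesgue_rV R n]_(x in D) (enorm (x - z) ^- n.-1)%:E <=
    (4 ^+ n * eta)%:E + (eta ^- n.-1)%:E * lebesgue_rV R n D)%E.
Proof.
move=> n1 eta0 mD.
have pot0 (x : 'rV[R]_n) : (0 <= (enorm (x - z) ^- n.-1)%:E)%E.
  by rewrite lee_fin invr_ge0 exprn_ge0// enorm_ge0.
have mpot D' : measurable_fun D' (fun x : 'rV[R]_n => (enorm (x - z) ^- n.-1)%:E).
  by apply/measurable_EFinP; apply: measurable_funTS; exact: measurable_potential.
have mB := measurable_ball_rV z eta.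
have DE : D = (D `&` ball z eta) `|` (D `\` (D `&` ball z eta)).
  by rewrite setDUK.
rewrite [X in (\int[_]_(x in X) _ <= _)%E]DE ge0_integral_setU//; first last.
- by apply/disj_setPS => x [DBx [_ nDBx]].
- by apply: measurableD => //; exact: measurableI.
- exact: measurableI.
apply: leeD.
  apply: le_trans (potential_ball_le z n1 eta0).
  apply: ge0_subset_integral => //; first exact: measurableI.
rewrite -integral_cst//.
apply: (@le_trans _ _ (\int[lebesgue_rV R n]_(x in D `\` (D `&` ball z eta))
  cst (eta ^- n.-1)%:E x)%E).
  apply: ge0_le_integral => //; first by apply: measurableD => //; exact: measurableI.
  move=> x [Dx nB]; rewrite lee_fin /cst.
  have ex : eta <= enorm (x - z).
    rewrite leNgt; apply/negP => xe; apply: nB; split=> //.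
    rewrite -ball_normE /= distrC; apply: le_lt_trans xe; exact: norm_le_enorm.
  rewrite lef_pV2 ?posrE ?exprn_gt0 ?(lt_le_trans eta0)//.
  by apply: lerXn2r; rewrite ?nnegrE ?enorm_ge0 ?(ltW eta0).
apply: ge0_subset_integral => //; first by apply: measurableD => //; exact: measurableI.
by move=> x _; rewrite lee_fin invr_ge0 exprn_ge0// ltW.
Qed.
(** * Comparison of the domain with a ball *)

Lemma nu_integral_density (R : realType) n (D : set 'rV[R]_n) (f : 'rV[R]_n -> R) :
  measurable D -> D `<=` unit_ball R n -> measurable_fun D f ->
  (\int[nu R n]_(x in D) (f x)%:E =
   \int[lebesgue_rV R n]_(x in D) (f x * hyp_density x)%:E)%E.
Proof.
move=> mD DB mf.
have mfE : measurable_fun D (EFin \o f) by exact/measurable_EFinP.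
rewrite integralE [RHS]integralE; congr (_ - _)%E.
- rewrite ge0_nu_integral//; last exact: measurable_funepos.
  apply: eq_integral => x; rewrite inE => Dx.
  rewrite !funeposE -!EFin_max -EFinM maxr_pMl ?mul0r//.
  exact: hyp_density_ge0 (DB x Dx).
- rewrite ge0_nu_integral//; last exact: measurable_funeneg.
  apply: eq_integral => x; rewrite inE => Dx.
  rewrite !funenegE -!EFinN -!EFin_max -EFinM maxr_pMl ?mul0r ?mulNr//.
  exact: hyp_density_ge0 (DB x Dx).
Qed.

Lemma C1_grad_H_harmonic (R : realType) n (U : set 'rV[R]_n) (F : 'rV[R]_n -> R) dF ddF :
  open U -> C1_grad U F dF -> (forall i, C1_grad U (dF i) (ddF i)) ->
  (forall x, U x -> (1 - dotp x x) * (\sum_(i < n) ddF i i x) +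
     2 * (n%:R - 2) * (\sum_(i < n) x ord0 i * dF i x) = 0) ->
  H_harmonic U (fun x => Complex (F x) 0).
Proof.
move=> oU cF cdF harm.
have [C2F ddFE] := C1_C2_on oU cF cdF.
have c0 : C1_grad U (fun=> 0 : R) (fun _ _ => 0) := C1_cst 0.
have [C20 dd0E] := C1_C2_on oU c0 (fun=> c0).
split; [exact: C2F|exact: C20|move=> x Ux].
apply/eqP; rewrite eq_complex /=; apply/andP; split; apply/eqP.
  rewrite /invariant_laplacian /laplacian.
  rewrite (_ : reC _ = F)//.
  rewrite (_ : dotp x (gradient F x) = \sum_(i < n) x ord0 i * dF i x); last first.
    by apply: eq_bigr => i _; rewrite mxE (C1_partial _ cF).
  under eq_bigr => i _ do rewrite ddFE//.
  by rewrite sqr_enorm harm// mulr0.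
rewrite /invariant_laplacian /laplacian (_ : imC _ = fun=> 0)//.
rewrite (_ : dotp x (gradient _ x) = 0); last first.
  by apply: big1 => i _; rewrite mxE (C1_partial _ c0)// mulr0.
by rewrite big1 ?mulr0 ?addr0 ?mulr0// => i _; rewrite dd0E.
Qed.

Lemma measurable_enorm_ge (R : realType) n (r : R) :
  measurable [set x : 'rV[R]_n | r <= enorm x].
Proof.
rewrite (_ : [set x | _] = ~` [set x | enorm x < r]).
  by apply: measurableC; apply: open_measurable_rV; exact: open_enorm_lt.
by apply/seteqP; split=> x /=;
  [move=> h1; apply/negP; rewrite -leNgt|move/negP; rewrite -leNgt].
Qed.

Lemma measurable_enorm_shell (R : realType) n (r s : R) :
  measurable [set x : 'rV[R]_n | (r <= enorm x) && (enorm x < s)].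
Proof.
rewrite (_ : [set x | _] = [set x | r <= enorm x] `&` [set x | enorm x < s]).
  apply: measurableI; first exact: measurable_enorm_ge.
  by apply: open_measurable_rV; exact: open_enorm_lt.
by apply/seteqP; split=> x /= => [/andP//|[h1 h2]]; apply/andP.
Qed.

(** Piecewise linear in [s = |x|^2]. Continuity is enough, since the radial mean value property
    integrates the weight and never differentiates it. *)
Lemma cutoff (R : realType) (r' r1 : R) : 0 < r' -> r' < r1 ->
  exists qq : R -> R, [/\ continuous qq, forall s, 0 <= qq s <= 1,
    forall s, s <= r' ^+ 2 -> qq s = 1 & forall s, r1 ^+ 2 <= s -> qq s = 0].
Proof.
move=> r'0 r'r1; have r10 := lt_trans r'0 r'r1.
exists (fun s => Num.max 0 (Num.min 1 ((r1 ^+ 2 - s) / (r1 ^+ 2 - r' ^+ 2)))).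
have r12 : 0 < r1 ^+ 2 - r' ^+ 2 by rewrite subr_gt0 ltr_pXn2r// nnegrE ltW.
split=> s.
- apply: (@continuous_max _ _ (fun=> 0) _ s); first exact: cst_continuous.
  apply: (@continuous_min _ _ (fun=> 1) _ s); first exact: cst_continuous.
  apply: continuousM; last exact: cst_continuous.
  by apply: continuousB; [exact: cst_continuous|exact: cvg_id].
- by rewrite le_max lexx /= ge_max ler01 ge_min lexx.
- move=> sr; rewrite min_l ?max_r ?ler01//.
  by rewrite ler_pdivlMr// mul1r lerD2l lerN2.
- move=> sr; rewrite max_l// ge_min; apply/orP; right.
  by rewrite pmulr_lle0 ?invr_gt0// subr_le0.
Qed.

Lemma sqr_le_dotp (R : realType) n (x : 'rV[R]_n) r : 0 <= r ->
  (r ^+ 2 <= dotp x x) = (r <= enorm x).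
Proof. by move=> r0; rewrite -sqr_enorm ler_pXn2r// nnegrE enorm_ge0. Qed.

(** The hyperbolic density is itself radial, so it is absorbed into the weight and the Lebesgue
    version applies. *)
Lemma nu_mean_value_radial (R : realType) n (Omega : set 'rV[R]_n)
    (F : 'rV[R]_n -> R) dF ddF (r r1 : R) (qq : R -> R) :
  (2 <= n)%N -> 0 < r1 -> r1 < r -> r <= 1 -> hyp_harmonic_grad r F dF ddF ->
  continuous qq -> (forall s, 0 <= qq s <= 1) ->
  (forall s, r1 ^+ 2 <= s -> qq s = 0) ->
  measurable Omega -> Omega `<=` unit_ball R n ->
  (forall x, enorm x < r1 -> Omega x) ->
  measurable_fun Omega (fun x => qq (dotp x x) * (F x - F 0)) ->
  \int[nu R n]_(x in Omega) (qq (dotp x x) * (F x - F 0)) = 0.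
Proof.
move=> n2 r10 r1r r_le1 hF cqq qq01 qq0 mOmega Omega_ball BO mqh.
have r1_1 : 0 < 1 - r1 ^+ 2.
  by rewrite subr_gt0 expr_lt1 ?(ltW r10)//; exact: lt_le_trans r_le1.
have min1 s : 1 - r1 ^+ 2 <= 1 - Num.min s (r1 ^+ 2).
  by rewrite lerD2l lerN2 ge_min lexx orbT.
have min0 s : 0 < 1 - Num.min s (r1 ^+ 2) by exact: lt_le_trans (min1 s).
(* The density is frozen from [r1 ^+ 2] on, where [qq] vanishes anyway; the weight is thus
   continuous and bounded on the whole line although the density blows up at [s = 1]. *)
pose beta (s : R) : R := qq s * (1 - Num.min s (r1 ^+ 2)) ^- n.
have cbeta (s : R) : {for s, continuous beta}.
  apply: continuousM; first exact: cqq.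
  apply: continuousV; first by rewrite expf_neq0// gt_eqF.
  apply: (@continuous_comp _ _ _ (fun s : R => 1 - Num.min s (r1 ^+ 2)) (fun s => s ^+ n)).
    apply: continuousB; first exact: cst_continuous.
    apply: (@continuous_min _ _ id (fun=> r1 ^+ 2) s); first exact: cvg_id.
    exact: cst_continuous.
  exact: exprn_continuous.
have beta_le s : 0 <= beta s <= (1 - r1 ^+ 2) ^- n.
  have /andP[q0 q1] := qq01 s; have m2 := min0 s.
  apply/andP; split; first by rewrite mulr_ge0// invr_ge0 exprn_ge0// ltW.
  rewrite -[leRHS]mul1r; apply: ler_pM => //; first by rewrite invr_ge0 exprn_ge0// ltW.
  rewrite lef_pV2 ?posrE ?exprn_gt0//.
  by apply: lerXn2r => //; rewrite nnegrE ltW.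
have beta0 s : r1 ^+ 2 <= s -> beta s = 0 by move=> /qq0; rewrite /beta => ->; rewrite mul0r.
have [_ Ibeta] := mean_value_radial n2 r10 r1r r_le1 hF cbeta beta_le beta0.
rewrite /Rintegral nu_integral_density// -[RHS]/(fine 0%E) -Ibeta; congr fine.
rewrite integral_mkcond; apply: eq_integral => x _.
rewrite /patch; case: ifPn => [|]; rewrite ?inE ?notin_setE => Ox.
  congr EFin; rewrite /beta /hyp_density sqr_enorm.
  have [sr|sr] := leP (r1 ^+ 2) (dotp x x); first by rewrite qq0// !mul0r.
  by rewrite mulrAC; congr (_ * _); rewrite min_l// ltW.
rewrite beta0 ?mul0r// sqr_le_dotp ?(ltW r10)// leNgt; apply/negP => xr1.
exact/Ox/BO.
Qed.

Lemma nu_potential_shell_le (R : realType) n (D : set 'rV[R]_n) (z : 'rV[R]_n) (r : R) :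
  measurable D -> r < 1 -> (forall x, D x -> enorm x <= r) ->
  (\int[nu R n]_(x in D) (enorm (x - z) ^- n.-1)%:E <=
    ((1 - r ^+ 2) ^- n)%:E *
      \int[lebesgue_rV R n]_(x in D) (enorm (x - z) ^- n.-1)%:E)%E.
Proof.
move=> mD r1 Dr.
have DB : D `<=` unit_ball R n by move=> x /Dr xr; exact: le_lt_trans r1.
have pot0 (x : 'rV[R]_n) : 0 <= enorm (x - z) ^- n.-1.
  by rewrite invr_ge0 exprn_ge0// enorm_ge0.
have mpot : measurable_fun D (fun x : 'rV[R]_n => enorm (x - z) ^- n.-1).
  by apply: measurable_funTS; exact: measurable_potential.
have [->|/set0P[x0 Dx0]] := eqVneq D set0.
  by rewrite !integral_set0 mule0.
have c0 : 0 <= (1 - r ^+ 2) ^- n.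
  by apply: le_trans (hyp_density_le r1 (Dr x0 Dx0)); exact: hyp_density_ge0 (DB x0 Dx0).
rewrite nu_integral_density// -ge0_integralZl//; last 2 first.
- exact/measurable_EFinP.
- by move=> x _; rewrite lee_fin.
apply: ge0_le_integral => //.
- by move=> x /DB/hyp_density_ge0 ?; rewrite lee_fin mulr_ge0.
- apply/measurable_EFinP; apply: measurable_funM => //.
  by apply/measurable_EFinP; exact: measurable_hyp_densityW.
- by apply/measurable_EFinP; apply: measurable_funM.
- move=> x Dx; rewrite -EFinM lee_fin mulrC ler_wpM2r//.
  exact: hyp_density_le (Dr x Dx).
Qed.

(** [r0], [r2] and [Z] are squared norms where this is applied. As [t0] lies between [r0] and [T2],
    neither the gap nor [v0] degenerates while the pole moves in the shell. *)
Lemma kuran_gap_ge (R : realType) (q r0 r2 Z v0 t0 v2 T2 : R) :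
  0 <= q -> 0 < r0 -> r0 <= Z -> Z <= r2 -> r2 < 1 ->
  v0 = (1 - Z)^-1 -> t0 = Z * v0 -> v2 = (1 - r2)^-1 -> T2 = r2 * v2 ->
  [/\ 0 <= v0, v0 <= v2 & r0 * (T2 + T2 ^+ 2) `^ (- q) <= t0 * (t0 + t0 ^+ 2) `^ (- q)].
Proof.
move=> q0 r00 r0Z Zr2 r21 -> -> -> ->.
have Z1 : 0 < 1 - Z by lra.
have R1 : 0 < 1 - r2 by lra.
have vle : (1 - Z)^-1 <= (1 - r2)^-1 by rewrite lef_pV2 ?posrE//; lra.
have v1 : 1 <= (1 - Z)^-1 by rewrite invf_ge1//; lra.
have Z0 : 0 < Z by lra.
have t0_ge : r0 <= Z * (1 - Z)^-1 by apply: le_trans r0Z _; rewrite ler_peMr// ltW.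
have t0_le : Z * (1 - Z)^-1 <= r2 * (1 - r2)^-1 by apply: ler_pM => //; lra.
have t0_gt0 := lt_le_trans r00 t0_ge; have T0 := lt_le_trans t0_gt0 t0_le.
have tt (s : R) : 0 < s -> 0 < s + s ^+ 2 by move=> s0; rewrite addr_gt0// exprn_gt0.
split => //; first by lra.
apply: ler_pM => //; [exact: ltW|exact: powR_ge0|].
rewrite !powRN lef_pV2 ?posrE ?powR_gt0 ?tt//.
apply: ge0_ler_powR => //; rewrite ?nnegrE.
- exact: ltW (tt _ t0_gt0).
- exact: ltW (tt _ T0).
by rewrite lerD// ler_pXn2r// nnegrE ltW.
Qed.

(** Here condition (iv) enters. A point of the closure outside [Omega] is a boundary point of
    [Omega], hence of its closure; so none of its neighbourhoods lies in the closure, and exterior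
    points occur arbitrarily close to it. *)
Lemma exterior_point (R : realType) n (Omega : set 'rV[R]_n) (r s : R) :
  boundary Omega `&` unit_ball R n = boundary (closure Omega) `&` unit_ball R n ->
  (forall x, enorm x < r -> Omega x) ->
  s <= 1 -> (exists2 x, ~ Omega x & enorm x < s) ->
  exists z, [/\ ~ closure Omega z, r <= enorm z & enorm z < s].
Proof.
move=> Obd BO s1 [x nOx xs].
suff [z nOz zs] : exists2 z, ~ closure Omega z & enorm z < s.
  exists z; split=> //; rewrite leNgt; apply/negP => /BO Oz.
  by apply: nOz; exact: subset_closure.
have [Ox|nOx'] := pselect (closure Omega x); last by exists x.
have : (boundary Omega `&` unit_ball R n) x.
  split; last by rewrite /unit_ball /=; exact: lt_le_trans s1.
  by split=> // /interior_subset.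
rewrite Obd => -[[_ niO] _].
apply: contrapT => H; apply: niO.
have : nbhs x [set y | enorm y < s].
  by apply: open_nbhs_nbhs; split=> //; exact: open_enorm_lt.
apply: filterS => y /= ys; apply: contrapT => nOy; apply: H.
by exists y.
Qed.

(** The density is at least [1] on the unit ball, so a cube inside [W] would have positive
    measure. *)
Lemma nu_open_null (R : realType) n (W : set 'rV[R]_n) :
  open W -> W `<=` unit_ball R n -> nu R n W = 0%E -> W = set0.
Proof.
move=> oW WB W0; rewrite -subset0 => y Wy.
have /nbhs_ballP[e /= e0 eW] : nbhs y W by exact: open_nbhs_nbhs.
pose B := ball y e; have mB : measurable B by exact: measurable_ball_rV.
have h2 : (1%:E * lebesgue_rV R n B <= nu R n B)%E.
  by apply: nu_ge_lebesgue => // x /eW/WB //; exact: hyp_density_ge1.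
have h3 : (nu R n B <= nu R n W)%E.
  by apply: le_measure; rewrite ?inE//; exact: open_measurable_rV.
have := le_trans h2 h3; rewrite W0 mul1e lebesgue_rV_ball// lee_fin leNgt.
by rewrite exprn_gt0// mulr_gt0.
Qed.

(** * Integral estimates on a domain with the mean value property *)

Section mean_value_domain.
Context {R : realType} {n : nat}.
Variable Omega : set 'rV[R]_n.
Hypotheses (n_ge2 : (2 <= n)%N) (Omega_ball : Omega `<=` unit_ball R n)
  (Omega_open : open Omega) (nu_finite : (nu R n Omega < +oo)%E)
  (mean_value : forall f : 'rV[R]_n -> R[i],
    (exists U : set 'rV[R]_n,
      [/\ open U, U `<=` unit_ball R n,
          closure Omega `&` unit_ball R n `<=` U & H_harmonic U f]) ->
    nu_integrable Omega f ->
    ((fine (nu R n Omega))^-1)%:C%C * nu_integral Omega f = f 0).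

Let mOmega : measurable Omega. Proof. exact: open_measurable_rV. Qed.

Lemma mean_value_real (U : set 'rV[R]_n) (F : 'rV[R]_n -> R) dF ddF (M : R) :
  Omega 0 -> open U -> U `<=` unit_ball R n -> closure Omega `&` unit_ball R n `<=` U ->
  C1_grad U F dF -> (forall i, C1_grad U (dF i) (ddF i)) ->
  (forall x, U x -> (1 - dotp x x) * (\sum_(i < n) ddF i i x) +
     2 * (n%:R - 2) * (\sum_(i < n) x ord0 i * dF i x) = 0) ->
  (forall x, Omega x -> `|F x| <= M) ->
  (nu R n).-integrable Omega (EFin \o (fun x => F x - F 0)) /\
  \int[nu R n]_(x in Omega) (F x - F 0) = 0.
Proof.
move=> O0 oU UB OU cF cdF harm FM.
have OU' : Omega `<=` U.
  by move=> x Ox; apply: OU; split; [exact: subset_closure|exact: Omega_ball].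
have iF : (nu R n).-integrable Omega (EFin \o F).
  apply: measurable_bounded_integrable => //.
    apply: continuous_measurable_rV => // x /OU' Ux.
    by have [] := cF x Ux.
  exists M; split; first exact: num_real.
  by move=> N MN x /FM h; exact: le_trans h (ltW MN).
have ic : (nu R n).-integrable Omega (EFin \o (fun=> F 0)).
  apply: measurable_bounded_integrable => //.
  exists `|F 0|; split; first exact: num_real.
  by move=> N MN x _ /=; exact: ltW.
split; first by have := integrableB mOmega iF ic.
(* A cube around [0] inside [Omega] makes the total measure positive, so that the inverse in the
   mean value formula can be cleared. *)
have nuO : 0 < fine (nu R n Omega).
  rewrite fine_gt0// nu_finite andbT.
  have [e e0 eO] : exists2 e : R, 0 < e & ball (0 : 'rV[R]_n) e `<=` Omega.
    have /nbhs_ballP[e /= e0 eO] : nbhs (0 : 'rV[R]_n) Omega by exact: open_nbhs_nbhs.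
    by exists e.
  pose B := ball (0 : 'rV[R]_n) e; have mB : measurable B by exact: measurable_ball_rV.
  have h1 : (0 < 1%:E * lebesgue_rV R n B)%E.
    by rewrite mul1e lebesgue_rV_ball// lte_fin exprn_gt0// mulr_gt0.
  have h2 : (1%:E * lebesgue_rV R n B <= nu R n B)%E.
    by apply: nu_ge_lebesgue => // x /eO/Omega_ball //; exact: hyp_density_ge1.
  have h3 : (nu R n B <= nu R n Omega)%E.
    by apply: le_measure; rewrite ?inE.
  exact: lt_le_trans h1 (le_trans h2 h3).
rewrite RintegralB// Rintegral_cst//.
have := mean_value (f := fun x => Complex (F x) 0) _ _.
move=> /(_ (ex_intro _ U (And4 oU UB OU (C1_grad_H_harmonic oU cF cdF harm)))).
move=> /(_ (conj iF (integrable0 _ _))) /eqP.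
rewrite eq_complex /= => /andP[/eqP + _].
rewrite mul0r subr0 => <-.
rewrite mulrAC mulVf ?mul1r ?subrr// gt_eqF//.
Qed.

(** With [h = F - F 0], both [h] and [qq h] have integral [0] over [Omega]: the former by the
    assumed mean value property, the latter by the radial one. So [(1 - qq) h] integrates to [0],
    while it dominates [delta 1_E1 - C pot 1_E2] pointwise. *)
Lemma kuran_estimate (r0 r1 r2 r' : R) (z : 'rV[R]_n) :
  0 < r' -> r' < r1 -> r1 < r0 -> r2 < 1 ->
  (forall x, enorm x < r0 -> Omega x) ->
  ~ closure Omega z -> r0 <= enorm z -> enorm z < r2 ->
  forall v0 t0 delta : R, v0 = (1 - dotp z z)^-1 -> t0 = dotp z z * v0 ->
  delta = t0 * (t0 + t0 ^+ 2) `^ (- (n%:R / 2)) ->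
  (delta%:E * nu R n (Omega `&` [set x | (r0 <= enorm x)%R]) <=
    (2 * v0 ^+ 2)%:E * \int[nu R n]_(x in Omega `&`
      [set x | ((r' <= enorm x) && (enorm x < r2))%R]) (enorm (x - z) ^- n.-1)%:E)%E.
Proof.
move=> r'0 r'r1 r1r0 r21 BO nOz r0z zr2 v0 t0 delta v0E t0E deltaE.
have r'r0 := lt_trans r'r1 r1r0.
have Omega0 : Omega 0 by apply: BO; rewrite enorm0; exact: lt_trans r'r0.
have z1 : enorm z < 1 by exact: lt_trans r21.
have [e e0 eO] : exists2 e : R, 0 < e & forall x, Omega x -> e <= enorm (x - z).
  have /nbhs_ballP[e /= e0 eO] : nbhs z (~` closure Omega).
    by apply: open_nbhs_nbhs; split=> //; apply: closed_openC; exact: closed_closure.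
  exists e => // x Ox; rewrite leNgt; apply/negP => xe.
  apply: (eO x _ (subset_closure Ox)); rewrite -ball_normE /= distrC.
  by apply: le_lt_trans xe; exact: norm_le_enorm.
(* [d < e] keeps the closure of [Omega] off the ball removed around [z]; [d <= (r0 - r1) / 2] does
   the same for the ball of radius [rr], midway between [r1] and [r0]. *)
pose d := Num.min (e / 2) ((r0 - r1) / 2).
have d0 : 0 < d by rewrite lt_min !divr_gt0// subr_gt0.
have de : d < e by rewrite gt_min; apply/orP; left; lra.
have dr : d <= (r0 - r1) / 2 by rewrite ge_min lexx orbT.
have dz : d < enorm z by lra.
have [F [dF [ddF [[cF cdF harm] Fout Fin [M FM]]]]] :=
  kuran_function_exists n_ge2 d0 dz z1.
rewrite -v0E -t0E -deltaE in Fout Fin.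
set U := [set x | enorm x < 1 /\ d < enorm (x - z)] in cF cdF harm Fout Fin FM.
have oU : open U.
  apply: openI; first exact: open_enorm_lt.
  apply: (@open_comp _ _ (fun x : 'rV[R]_n => enorm (x - z)) [set t | d < t]); last exact: open_gt.
  by move=> x _; exact: continuous_enormB.
have OU : closure Omega `&` unit_ball R n `<=` U.
  move=> x [Ox xB]; split=> //; apply: lt_le_trans de _.
  have cl : closed [set x : 'rV[R]_n | e <= enorm (x - z)].
    apply: (@closed_comp _ _ (fun x : 'rV[R]_n => enorm (x - z)) [set t | e <= t]); last exact: closed_ge.
    by move=> y _; exact: continuous_enormB.
  have sub : closure Omega `<=` closure [set x : 'rV[R]_n | e <= enorm (x - z)].
    exact: closure_subset.
  by rewrite -((closure_id _).1 cl) in sub; exact: sub.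
have OU' : Omega `<=` U.
  by move=> x Ox; apply: OU; split; [exact: subset_closure|exact: Omega_ball].
have [ih Ih] := mean_value_real Omega0 oU (fun x => @proj1 _ _) OU cF cdF harm
  (fun x Ox => FM x (OU' x Ox)).
pose h x := F x - F 0.
have [qq [cqq qq01 qq1 qq0]] := cutoff r'0 r'r1.
pose rr := (r0 + r1) / 2.
have rrU x : enorm x < rr -> U x.
  move=> xr; split; first by rewrite /rr in xr; lra.
  by have := enormB_ge z x; rewrite enormBC /rr in xr *; lra.
have hg : hyp_harmonic_grad rr F dF ddF.
  split=> [x /rrU/cF//|j x /rrU/cdF//|x /rrU/harm//].
have r10 : 0 < r1 by lra.
have r1rr : r1 < rr by rewrite /rr; lra.
have rr1 : rr <= 1 by rewrite /rr; lra.
have mh : measurable_fun Omega h.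
  by have [/measurable_EFinP] := integrableP _ _ _ ih.
have mqq : measurable_fun Omega (fun x : 'rV[R]_n => qq (dotp x x)).
  apply: continuous_measurable_rV => // x _.
  apply: (@continuous_comp _ _ _ (fun y : 'rV[R]_n => dotp y y) qq).
    exact: continuous_dotp.
  exact: cqq.
have mqh : measurable_fun Omega (fun x : 'rV[R]_n => qq (dotp x x) * h x).
  exact: measurable_funM.
have iqh : (nu R n).-integrable Omega (EFin \o (fun x => qq (dotp x x) * h x)).
  apply: le_integrable ih => //; first exact/measurable_EFinP.
  move=> x _; rewrite /= lee_fin normrM ler_piMl//.
  by have /andP[? ?] := qq01 (dotp x x); rewrite ger0_norm.
have Iqh : \int[nu R n]_(x in Omega) (qq (dotp x x) * h x) = 0.
  have r1Omega x : enorm x < r1 -> Omega x by move=> xr; apply: BO; exact: lt_trans r1r0.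
  exact: nu_mean_value_radial n_ge2 r10 r1rr rr1 hg cqq qq01 qq0 mOmega Omega_ball
    r1Omega mqh.
pose E1 := Omega `&` [set x | r0 <= enorm x].
pose E2 := Omega `&` [set x | (r' <= enorm x) && (enorm x < r2)].
pose pot (x : 'rV[R]_n) := enorm (x - z) ^- n.-1.
have mE1 : measurable E1 by apply: measurableI => //; exact: measurable_enorm_ge.
have mE2 : measurable E2 by apply: measurableI => //; exact: measurable_enorm_shell.
have finE E : measurable E -> E `<=` Omega -> (nu R n E < +oo)%E.
  by move=> mE EO; apply: le_lt_trans nu_finite; apply: le_measure; rewrite ?inE.
have i1 : (nu R n).-integrable Omega (EFin \o (\1_E1 : 'rV[R]_n -> R)).
  apply: measurable_bounded_integrable => //.
  exists 1; split; first exact: num_real.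
  move=> N N1 x _ /=; apply: le_trans (ltW N1).
  by rewrite indicE ger0_norm// lern1 leq_b1.
have pot0 x : 0 <= pot x by rewrite invr_ge0 exprn_ge0// enorm_ge0.
have i2 : (nu R n).-integrable Omega (EFin \o (fun x => pot x * \1_E2 x)).
  apply: measurable_bounded_integrable => //.
    apply: measurable_funM; first by apply: measurable_funTS; exact: measurable_potential.
    exact: measurable_indic.
  exists (d ^- n.-1); split; first exact: num_real.
  move=> N N1 x /OU' [_ dx] /=; apply: le_trans (ltW N1).
  rewrite normrM (ger0_norm (pot0 x)) -[leRHS]mulr1; apply: ler_pM => //.
    have xz0 : 0 < enorm (x - z) by apply: lt_trans dx.
    rewrite /pot lef_pV2 ?posrE ?exprn_gt0//.
    by apply: lerXn2r; rewrite ?nnegrE ?enorm_ge0 ?(ltW d0)// ltW.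
  by rewrite indicE ger0_norm// lern1 leq_b1.
have Iu : \int[nu R n]_(x in Omega) (h x - qq (dotp x x) * h x) = 0.
  by rewrite RintegralB// Ih Iqh subrr.
set C := 2 * v0 ^+ 2.
have C0 : 0 <= C by rewrite /C mulr_ge0// sqr_ge0.
have Z1 : 0 < 1 - dotp z z by rewrite subr_gt0 -sqr_enorm expr_lt1// enorm_ge0.
have delta0 : 0 <= delta.
  rewrite deltaE mulr_ge0 ?powR_ge0// t0E v0E.
  by rewrite mulr_ge0 ?dotp_ge0// invr_ge0 ltW.
have iZl c (f : 'rV[R]_n -> R) : (nu R n).-integrable Omega (EFin \o f) ->
    (nu R n).-integrable Omega (EFin \o (fun x => c * f x)).
  by move=> iff; have := integrableZl mOmega c iff.
(* Below [r'] both sides vanish. Beyond [|z|] the gap is available in full. In between, the point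
   lies in [E2], and what is missing from the gap is charged to the potential. *)
have key : \int[nu R n]_(x in Omega) (delta * \1_E1 x - C * (pot x * \1_E2 x)) <= 0.
  rewrite -[leRHS]Iu; apply: le_Rintegral => //.
  - by have := integrableB mOmega (iZl delta _ i1) (iZl C _ i2).
  - by have := integrableB mOmega ih iqh.
  move=> x Ox; have Ux := OU' x Ox; have /andP[q0 q1] := qq01 (dotp x x).
  have hE : h x - qq (dotp x x) * h x = (1 - qq (dotp x x)) * h x by ring.
  have [xr'|r'x] := ltP (enorm x) r'.
    rewrite hE qq1; last by rewrite -sqr_enorm ler_pXn2r ?nnegrE ?enorm_ge0 ?ltW.
    rewrite subrr mul0r !indicE memNset; last first.
      by move=> [_ /=]; rewrite leNgt (lt_trans xr' r'r0).
    rewrite memNset; last by move=> [_ /= /andP[]]; rewrite leNgt xr'.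
    by rewrite !mulr0 subrr.
  have E1le : delta * \1_E1 x <= (1 - qq (dotp x x)) * delta.
    rewrite indicE; case: (boolP (x \in E1)) => [|_] /=; rewrite ?mulr0 ?mulr1.
      rewrite inE => -[_ /= xr0]; rewrite qq0 ?subr0 ?mul1r//.
      by rewrite sqr_le_dotp ?(ltW r10)// (le_trans (ltW r1r0)).
    by rewrite mulr_ge0// subr_ge0.
  have [zx|xz] := leP (enorm z) (enorm x).
    have hx : delta <= h x by rewrite /h lerBrDl; exact: Fout.
    rewrite hE; apply: (@le_trans _ _ (delta * \1_E1 x)).
      by rewrite gerBl mulr_ge0// mulr_ge0// indicE.
    by apply: le_trans E1le _; rewrite ler_wpM2l// subr_ge0.
  have hx : delta - C * pot x <= h x.
    by rewrite /h lerBrDl addrA; exact: Fin.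
  have -> : \1_E2 x = 1 :> R.
    by rewrite indicE mem_set//; split=> //=; rewrite r'x (lt_trans xz).
  rewrite hE; apply: (@le_trans _ _ ((1 - qq (dotp x x)) * (delta - C * pot x))); last first.
    by rewrite ler_wpM2l// subr_ge0.
  rewrite mulr1 mulrBr; apply: lerB => //.
  by apply: ler_piMl; [exact: mulr_ge0|rewrite gerBl].
rewrite RintegralB// ?RintegralZl// in key; [|exact: iZl|exact: iZl].
rewrite subr_le0 in key.
have IE1 : (\int[nu R n]_(x in Omega) (\1_E1 x))%R = fine (nu R n E1).
  by rewrite /Rintegral integral_indic// setIidl// => x [].
have IE2 : ((\int[nu R n]_(x in Omega) (pot x * \1_E2 x))%R)%:E =
    (\int[nu R n]_(x in E2) (pot x)%:E)%E.
  rewrite /Rintegral fineK; last by have := integrable_fin_num mOmega i2.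
  rewrite -[in RHS](setIidr (_ : E2 `<=` Omega)); last by move=> x [].
  rewrite integral_mkcondr; apply: eq_integral => x _.
  by rewrite patchE indicE; case: (boolP (x \in E2)) => _ /=; rewrite ?mulr1 ?mulr0.
rewrite -[X in (_ * X <= _)%E]fineK; last by rewrite ge0_fin_numE// finE// => x [].
by rewrite -IE2 -!EFinM lee_fin -IE1.
Qed.

(** The constants up to [Kc] depend on [r0] and [n] alone. Then [tau] determines [eta], [eta] the
    half-width [e] of the shell, and [e] the exterior point [z]; the measure is at most
    [tau * (Kc / dmin)] for every [tau]. *)
Lemma nu_outside_ball (r0 : R) : 0 < r0 -> r0 < 1 ->
  (forall x, enorm x < r0 -> Omega x) ->
  (forall e, 0 < e -> exists2 x, ~ Omega x & enorm x < r0 + e) ->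
  boundary Omega `&` unit_ball R n = boundary (closure Omega) `&` unit_ball R n ->
  nu R n (Omega `&` [set x | r0 <= enorm x]) = 0%E.
Proof.
move=> r0_gt0 r0_lt1 BO approx Omega_boundary.
have n_gt0 : (0 < n)%N by exact: ltnW.
pose r2 : R := (1 + r0) / 2.
have r2_lt1 : r2 < 1 by rewrite /r2; lra.
have r02 : r0 < r2 by rewrite /r2; lra.
have r2_gt0 : 0 < r2 := lt_trans r0_gt0 r02.
have r22_lt1 : r2 ^+ 2 < 1 by rewrite expr_lt1// ltW.
have v2E := erefl ((1 - r2 ^+ 2)^-1); set v2 : R := (X in X = _) in v2E.
have v2_gt0 : 0 < v2 by rewrite invr_gt0 subr_gt0.
have T2E := erefl (r2 ^+ 2 * v2); set T2 : R := (X in X = _) in T2E.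
(* A lower bound for the gap common to all poles with [r0 <= |z| <= r2]. *)
pose dmin : R := r0 ^+ 2 * (T2 + T2 ^+ 2) `^ (- (n%:R / 2)).
have T2_gt0 : 0 < T2 by rewrite mulr_gt0// exprn_gt0.
have dmin_gt0 : 0 < dmin.
  by rewrite mulr_gt0 ?exprn_gt0 ?powR_gt0 ?addr_gt0// exprn_gt0.
(* [2 * v2 ^+ 2] bounds the constant [2 * v0 ^+ 2] of the test function, and [v2 ^+ n] the
   hyperbolic density on the shell. *)
pose Kc : R := 2 * v2 ^+ 2 * v2 ^+ n.
have Kc_ge0 : 0 <= Kc by rewrite !mulr_ge0 ?exprn_ge0 ?ltW.
pose E1 := Omega `&` [set x | r0 <= enorm x].
have mE1 : measurable E1 by apply: measurableI => //; exact: measurable_enorm_ge.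
have E1_fin : nu R n E1 \is a fin_num.
  rewrite ge0_fin_numE//; apply: le_lt_trans nu_finite.
  by apply: le_measure; rewrite ?inE// => x [].
rewrite -/E1 -(fineK E1_fin); congr EFin.
apply: (@small_multiple_eq0 _ _ (Kc / dmin)); first by rewrite divr_ge0// ltW.
move=> tau tau0; rewrite ger0_norm ?fine_ge0// mulrA ler_pdivlMr// mulrC (mulrC tau).
rewrite -lee_fin EFinM fineK//.
(* The part of the potential near [z] is then at most [tau / 2], and a shell of volume at most
   [tau / 2 * eta ^+ n.-1] makes the far part at most [tau / 2] too. *)
pose eta : R := tau / (2 * 4 ^+ n).
have eta0 : 0 < eta by rewrite divr_gt0// mulr_gt0// exprn_gt0.
have tau'0 : 0 < tau / 2 * eta ^+ n.-1 by rewrite mulr_gt0 ?exprn_gt0// divr_gt0.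
have [e1 e10 [e1r0 annulus]] := annulus_small n_gt0 r0_gt0 tau'0.
pose e : R := Num.min e1 ((1 - r0) / 2).
have e0 : 0 < e by rewrite lt_min e10 divr_gt0// subr_gt0.
have ee1 : e <= e1 by rewrite ge_min lexx.
have er2 : r0 + e <= r2.
  rewrite (_ : r2 = r0 + (1 - r0) / 2); last by rewrite /r2; field.
  by rewrite lerD2l ge_min lexx orbT.
have s1 : r0 + e < 1 := le_lt_trans er2 r2_lt1.
have [z [nOz r0z zr]] := exterior_point Omega_boundary BO (ltW s1) (approx e e0).
have r'0 : 0 < r0 - e by rewrite subr_gt0 (le_lt_trans ee1).
have e2 : e / 2 < e by rewrite ltr_pdivrMr// mulr_natr mulr2n ltrDl.
have r'r1 : r0 - e < r0 - e / 2 by rewrite ltrD2l ltrN2.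
have r1r0 : r0 - e / 2 < r0 by rewrite gtrBl divr_gt0.
have := kuran_estimate r'0 r'r1 r1r0 s1 BO nOz r0z zr erefl erefl erefl.
rewrite -/E1; set D := Omega `&` _ => est.
have Z2 : dotp z z <= r2 ^+ 2.
  by rewrite -sqr_enorm ler_pXn2r ?nnegrE ?enorm_ge0 ?(ltW r2_gt0)// (le_trans (ltW zr)).
have Z0 : r0 ^+ 2 <= dotp z z by rewrite sqr_le_dotp// ltW.
have q0 : 0 <= n%:R / 2 :> R by rewrite divr_ge0.
have [v0_ge0 v02 delta_ge] := kuran_gap_ge q0 (exprn_gt0 2 r0_gt0) Z0 Z2 r22_lt1
  erefl erefl v2E T2E.
apply: le_trans (le_trans est _).
  by apply: lee_wpmul2r => //; rewrite lee_fin.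
have mD : measurable D.
  by apply: measurableI => //; exact: measurable_enorm_shell.
have Dr2 x : D x -> enorm x <= r2.
  by move=> [_ /= /andP[_ xr]]; exact: le_trans (ltW xr) er2.
have Dvol : (lebesgue_rV R n D <= (tau / 2 * eta ^+ n.-1)%:E)%E.
  apply: le_trans annulus; apply: le_measure; rewrite ?inE//.
    exact: measurable_enorm_shell.
  move=> x [_ /= /andP[h1 h2]]; rewrite (le_trans _ h1) ?lerD2l ?lerN2//=.
  by rewrite (lt_le_trans h2)// lerD2l.
have Ileb : (\int[lebesgue_rV R n]_(x in D) (enorm (x - z) ^- n.-1)%:E <= tau%:E)%E.
  apply: le_trans (potential_le z n_ge2 eta0 mD) _.
  have -> : tau = 4 ^+ n * eta + eta ^- n.-1 * (tau / 2 * eta ^+ n.-1).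
    by rewrite /eta; field; rewrite ?expf_neq0 ?gt_eqF.
  rewrite EFinD leeD// EFinM; apply: lee_wpmul2l => //.
  by rewrite lee_fin invr_ge0 exprn_ge0// ltW.
have Inu : (\int[nu R n]_(x in D) (enorm (x - z) ^- n.-1)%:E <= (v2 ^+ n * tau)%:E)%E.
  apply: le_trans (nu_potential_shell_le z mD r2_lt1 Dr2) _.
  rewrite -exprVn -/v2 EFinM; apply: lee_wpmul2l => //.
  by rewrite lee_fin exprn_ge0// ltW.
have -> : Kc * tau = 2 * v2 ^+ 2 * (v2 ^+ n * tau) by rewrite /Kc mulrA.
rewrite [leRHS]EFinM; apply: lee_pmul => //.
- by rewrite lee_fin mulr_ge0// sqr_ge0.
- apply: integral_ge0 => x _; rewrite lee_fin invr_ge0 exprn_ge0//.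
  exact: enorm_ge0.
- by rewrite lee_fin ler_wpM2l// lerXn2r// nnegrE (le_trans v0_ge0).
Qed.

End mean_value_domain.

Theorem theorem1p1 (R : realType) (n : nat) (n_ge2 : (2 <= n)%N)
    (Omega : set 'rV[R]_n)
    (Omega_ball : Omega `<=` unit_ball R n)
    (Omega_open : open Omega)
    (Omega_connected : connected Omega)
    (Omega_0 : Omega 0)
    (nu_finite : (nu R n Omega < +oo)%E)
    (potential_locally_bounded : forall K : set 'rV[R]_n,
      compact K -> K `<=` unit_ball R n ->
      (nnsup [set nu_potential Omega z | z in K] < +oo)%E)
    (potential_at_sphere :
      (((1 - r ^+ 2) ^+ (n - 2))%:E *
        nnsup [set nu_potential Omega z
              | z in Omega `&` [set z : 'rV[R]_n | enorm z = r]])%E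
        @[r --> (1 : R)^'-] --> 0%E)
    (Omega_boundary : boundary Omega `&` unit_ball R n =
                      boundary (closure Omega) `&` unit_ball R n)
    (mean_value : forall f : 'rV[R]_n -> R[i],
      (exists U : set 'rV[R]_n,
        [/\ open U, U `<=` unit_ball R n,
            closure Omega `&` unit_ball R n `<=` U & H_harmonic U f]) ->
      nu_integrable Omega f ->
      ((fine (nu R n Omega))^-1)%:C%C * nu_integral Omega f = f 0) :
  exists2 rho : R, 0 < rho < 1 &
    Omega = [set x | unit_ball R n x /\ enorm x < rho].
Proof.
have n_gt0 : (0 < n)%N by exact: ltnW.
pose S := [set enorm x | x in ~` Omega].
pose r0 : R := inf S.
have lbS : lbound S 0 by move=> _ [x _ <-]; exact: enorm_ge0.
(* A unit vector lies outside [Omega], so the infimum is over a nonempty set and is at most [1]. *)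
pose p : 'rV[R]_n := delta_mx ord0 (Ordinal n_gt0).
have p1 : enorm p = 1 by rewrite /p -[delta_mx _ _]scale1r enorm_delta normr1.
have Sp : S 1.
  by exists p => //; rewrite /setC /= => /Omega_ball; rewrite /unit_ball /= p1 ltxx.
have hS : has_inf S by split; [exists 1|exists 0].
have BO x : enorm x < r0 -> Omega x.
  move=> xr; apply: contrapT => nOx.
  have : r0 <= enorm x by apply: ge_inf; [exists 0|exists x].
  by rewrite leNgt xr.
have approx (e : R) : 0 < e -> exists2 x, ~ Omega x & enorm x < r0 + e.
  by move=> e0; have [_ [x nOx <-] xr] := inf_adherent e0 hS; exists x.
have r0_gt0 : 0 < r0.
  have /nbhs_ballP[e /= e0 eO] : nbhs (0 : 'rV[R]_n) Omega by exact: open_nbhs_nbhs.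
  apply: lt_le_trans e0 _; apply: lb_le_inf; first by exists 1.
  move=> _ [x nOx <-]; rewrite leNgt; apply/negP => xe; apply: nOx; apply: eO.
  by rewrite -ball_normE /= sub0r normrN; apply: le_lt_trans xe; exact: norm_le_enorm.
have r0_le1 : r0 <= 1 by apply: ge_inf => //; exists 0.
have r0_lt1 : r0 < 1.
  rewrite lt_neqAle r0_le1 andbT; apply/eqP => r01.
  have OB : Omega = unit_ball R n.
    by apply/seteqP; split=> // x x1; apply: BO; rewrite r01.
  by move: nu_finite; rewrite OB nu_unit_ball// ltxx.
have E1_0 := nu_outside_ball n_ge2 Omega_ball Omega_open nu_finite mean_value
  r0_gt0 r0_lt1 BO approx Omega_boundary.
have W0 : Omega `&` [set x | r0 < enorm x] = set0.
  have oW : open (Omega `&` [set x | r0 < enorm x]).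
    by apply: openI => //; exact: open_enorm_gt.
  apply: nu_open_null => //; first by move=> x [/Omega_ball].
  apply: subset_measure0 E1_0; first exact: open_measurable_rV.
    by apply: measurableI; [exact: open_measurable_rV|exact: measurable_enorm_ge].
  by move=> x [Ox /= xr]; split=> //=; exact: ltW.
exists r0; first by rewrite r0_gt0.
apply/seteqP; split=> [x Ox|x [_ /BO//]]; split; first exact: Omega_ball.
rewrite ltNge; apply/negP => r0x.
have /nbhs_ballP[e /= e0 eO] : nbhs x Omega by exact: open_nbhs_nbhs.
have x0 : 0 < `|x| + 1 by rewrite ltr_wpDl.
(* A point of [Omega] with norm at least [r0] is pushed radially outward by the factor [1 + s], with
   [s] so small that it stays in [Omega]; it then lies strictly beyond [r0], where [Omega] is empty.
   This excludes points on the sphere itself. *)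
pose s : R := e / (2 * (`|x| + 1)).
have s0 : 0 < s by rewrite divr_gt0// mulr_gt0.
have : (Omega `&` [set x | r0 < enorm x]) ((1 + s) *: x).
  split=> /=.
    apply: eO; rewrite -ball_normE /= scalerDl scale1r opprD addrA subrr sub0r normrN.
    rewrite normrZ gtr0_norm// /s mulrAC ltr_pdivrMr ?mulr_gt0//.
    by rewrite ltr_pM2l//; have := normr_ge0 x; lra.
  rewrite /enorm dotpZl dotpZr mulrA -expr2 sqrtrM ?sqr_ge0// sqrtr_sqr.
  rewrite ger0_norm; last by lra.
  rewrite mulrDl mul1r; apply: (le_lt_trans r0x).
  by rewrite ltrDl mulr_gt0//; exact: lt_le_trans r0x.
by rewrite W0.
Qed.
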